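(* Let $d\in\mathbb{N}$ and let $p$ be a real number with $1\le p<\infty$. There is a constant $C_{p,d}>0$, depending only on $p$ and $d$, such that the following holds. For every integer $t\ge0$ and every order $2$ digital $(t,d)$-sequence $\mathcal{S}_d$ over $\mathbb{F}_2$ with generating matrices $E_i=(e_{i,k,\ell})_{k,\ell\ge1}$, $i\in\{1,\dots,d\}$, for which $e_{i,k,\ell}=0$ for all $k>2\ell$ and all $i\in\{1,\dots,d\}$, one has $$L_{p,N}(\mathcal{S}_d)\le C_{p,d}\,2^t\,\frac{(\log N)^{d/2}}{N}\qquad\text{for all integers } N\ge2 .$$
   Context: $\mathbb{N}=\{1,2,3,\dots\}$, $\mathbb{N}_0=\mathbb{N}\cup\{0\}$; $\mathbb{F}_2$ is identified with $\{0,1\}$ with arithmetic modulo 2. **Discrepancy.** For a sequence $\mathcal{S}_d=(\boldsymbol{x}_k)_{k\ge0}$ in $[0,1)^d$ and $N\in\mathbb{N}$, put $$D_{\mathcal{S}_d}^N(\boldsymbol{x})=\frac1N\sum_{k=0}^{N-1}\chi_{[\boldsymbol 0,\boldsymbol x)}(\boldsymbol{x}_k)-x_1\cdots x_d,\qquad \boldsymbol{x}=(x_1,\dots,x_d)\in[0,1]^d,$$ where $[\boldsymbol 0,\boldsymbol x)=[0,x_1)\times\cdots\times[0,x_d)$ and $\chi_A$ is the characteristic function of $A$. The $L_p$-discrepancy is $L_{p,N}(\mathcal{S}_d)=\left(\int_{[0,1]^d}|D_{\mathcal{S}_d}^N(\boldsymbol{x})|^p\,d\boldsymbol{x}\right)^{1/p}$.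 **Digital sequence.** Let $C_1,\dots,C_d\in\mathbb{F}_2^{\mathbb{N}\times\mathbb{N}}$, $C_j=(c_{j,k,\ell})_{k,\ell\in\mathbb{N}}$ ($k$ the row, $\ell$ the column index), such that for each $\ell$ there is $K(\ell)$ with $c_{j,k,\ell}=0$ for all $k>K(\ell)$. For $k\in\mathbb{N}_0$ with binary expansion $k=k_0+k_12+k_22^2+\cdots$ let $\vec k=(k_0,k_1,k_2,\dots)^\top\in\mathbb{F}_2^{\mathbb{N}}$, let $C_j\vec k=(x_{j,k,1},x_{j,k,2},\dots)^\top$ (computed over $\mathbb{F}_2$), $x_{j,k}=\sum_{i\ge1}x_{j,k,i}2^{-i}\in[0,1)$ and $\boldsymbol{x}_k=(x_{1,k},\dots,x_{d,k})$. The sequence $(\boldsymbol{x}_k)_{k\ge0}$ is the digital sequence over $\mathbb{F}_2$ with generating matrices $C_1,\dots,C_d$. **Order $\alpha$ digital net.** Let $n,q,\alpha\in\mathbb{N}$ with $q\ge\alpha n$, and let $t$ be an integer with $0\le t\le\alpha n$. Matrices $C_1,\dots,C_d\in\mathbb{F}_2^{q\times n}$ generate an order $\alpha$ digital $(t,n,d)$-net over $\mathbb{F}_2$ if, writing $\vec c_{j,i}\in\mathbb{F}_2^n$ for the $i$-th row of $C_j$, for all choices of $\nu_1,\dots,\nu_d\in\mathbb{N}_0$ and indices $1\le i_{j,\nu_j}<\cdots<i_{j,1}\le q$ ($j=1,\dots,d$) with $$\sum_{j=1}^d\sum_{l=1}^{\min(\nu_j,\alpha)}i_{j,l}\le\alpha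 n-t$$ the vectors $\vec c_{1,i_{1,\nu_1}},\dots,\vec c_{1,i_{1,1}},\dots,\vec c_{d,i_{d,\nu_d}},\dots,\vec c_{d,i_{d,1}}$ are linearly independent over $\mathbb{F}_2$. **Order $\alpha$ digital sequence.** Let $\alpha\in\mathbb{N}$ and let $t\ge0$ be an integer. The digital sequence over $\mathbb{F}_2$ with generating matrices $C_1,\dots,C_d\in\mathbb{F}_2^{\mathbb{N}\times\mathbb{N}}$ is an order $\alpha$ digital $(t,d)$-sequence over $\mathbb{F}_2$ if for all $n\in\mathbb{N}$ with $n>t/\alpha$ the left upper $\alpha n\times n$ submatrices of $C_1,\dots,C_d$ generate an order $\alpha$ digital $(t,n,d)$-net over $\mathbb{F}_2$. *)

(* Defs.v *)
From HB Require Import structures.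
From mathcomp Require Import all_boot all_order all_algebra.
From mathcomp Require Import all_classical all_reals all_analysis.

Set Implicit Arguments.
Unset Strict Implicit.
Unset Printing Implicit Defensive.

Import Order.TTheory GRing.Theory Num.Theory.
Import numFieldNormedType.Exports.

Local Open Scope classical_set_scope.
Local Open Scope ring_scope.

Section ProductPushforward.
Context (R : realType) (d1 d2 d3 : measure_display).
Context (T1 : measurableType d1) (T2 : measurableType d2) (T3 : measurableType d3).
Variables (m1 : {sigma_finite_measure set T1 -> \bar R}).
Variables (m2 : {sigma_finite_measure set T2 -> \bar R}).
Local Open Scope ereal_scope.

Lemma sigma_finite_product : sigma_finite [set: T1 * T2] (m1 \x m2).
Proof.
have /sigma_finiteP[F [TF ndF Foo]] := sigma_finiteT m1.
have /sigma_finiteP[G [TG ndG Goo]] := sigma_finiteT m2.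
exists (fun n => F n `*` G n).
  rewrite -setXTT TF TG predeqE => -[x y]; split.
    move=> [/= [n _ Fnx] [k _ Gky]]; exists (maxn n k) => //; split.
    - by move: x Fnx; exact/subsetPset/ndF/leq_maxl.
    - by move: y Gky; exact/subsetPset/ndG/leq_maxr.
  by move=> [n _ []/= ? ?]; split; exists n.
move=> k; have [? ?] := Foo k; have [? ?] := Goo k.
split; first exact: measurableX.
by rewrite product_measure1E// lte_mul_pinfty// ge0_fin_numE.
Qed.

Lemma sigma_finite_measure_pushforward (f : T1 * T2 -> T3) (g : T3 -> T1 * T2) :
  measurable_fun [set: _] f -> measurable_fun [set: _] g -> cancel f g ->
  exists mu : {sigma_finite_measure set T3 -> \bar R},
    pushforward (m1 \x m2) f = mu.
Proof.
move=> mf mg fK.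
pose M : {measure set T3 -> \bar R} :=
  measure_function_pushforward__canonical__measure_function_Measure (m1 \x m2) mf.
have sf : sigma_finite setT M.
  have [F FT Foo] := sigma_finite_product.
  exists (fun k => g @^-1` F k).
    by rewrite -preimage_bigcup -FT preimage_setT.
  move=> k; have [mF Fk] := Foo k; split.
    by rewrite -[X in measurable X]setTI; exact: mg.
  rewrite /M /= /pushforward -comp_preimage (_ : _ \o _ = id) //.
  by apply/funext => x /=; rewrite fK.
pose S := Measure_isSigmaFinite.Build _ _ _ M sf.
pose M' : {sigma_finite_measure set T3 -> \bar R} :=
  HB.pack (M : set T3 -> \bar R) M S.
by exists M'.
Qed.
End ProductPushforward.

Section LebesgueTuple.
Context (R : realType).
Local Open Scope ereal_scope.

Definition tuple_of_pair d (p : measurableTypeR R * d.-tuple (measurableTypeR R)) :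
  d.+1.-tuple (measurableTypeR R) := [tuple of p.1 :: p.2].

(* Lebesgue measure on R^d (as d-tuples, with the product sigma-algebra): the
   d-fold product of the one-dimensional Lebesgue measure, see
   [lebesgue_tuple_box]. *)
Fixpoint lebesgue_tuple (d : nat) :
    set (d.-tuple (measurableTypeR R)) -> \bar R :=
  match d with
  | 0%N => dirac [tuple]
  | d'.+1 => pushforward (lebesgue_measure \x @lebesgue_tuple d')
               (@tuple_of_pair d')
  end.

Lemma measurable_tuple_of_pair d : measurable_fun [set: _] (@tuple_of_pair d).
Proof. by apply: measurable_cons. Qed.

Definition pair_of_tuple d (x : d.+1.-tuple (measurableTypeR R)) :
  measurableTypeR R * d.-tuple (measurableTypeR R) :=
  (thead x, [tuple of behead x]).

Lemma measurable_pair_of_tuple d : measurable_fun [set: _] (@pair_of_tuple d).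
Proof.
apply/measurable_fun_pairP; split.
  exact: measurable_tnth.
exact: measurable_behead.
Qed.

Lemma tuple_of_pairK d : cancel (@tuple_of_pair d) (@pair_of_tuple d).
Proof. by case=> x y; congr pair; apply: val_inj. Qed.

Lemma lebesgue_tuple_measureP d :
  exists mu : {sigma_finite_measure set (d.-tuple (measurableTypeR R)) -> \bar R},
    @lebesgue_tuple d = mu.
Proof.
elim: d => [|d [mu IH]].
  by exists (dirac [tuple]).
rewrite /= IH; apply: (sigma_finite_measure_pushforward lebesgue_measure mu).
- exact: measurable_tuple_of_pair.
- exact: measurable_pair_of_tuple.
- exact: tuple_of_pairK.
Qed.

HB.instance Definition _ (d : nat) :=
  let mu := projT1 (cid (lebesgue_tuple_measureP d)) in
  let E := projT2 (cid (lebesgue_tuple_measureP d)) in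
  isMeasure.Build _ _ _ (@lebesgue_tuple d)
    (eq_ind_r (fun m => m set0 = 0) (measure0 mu) E)
    (eq_ind_r (fun m : set _ -> \bar R => forall A, 0 <= m A) (measure_ge0 mu) E)
    (eq_ind_r (fun m : set _ -> \bar R => semi_sigma_additive m)
      (@measure_semi_sigma_additive _ _ _ mu) E).

HB.instance Definition _ (d : nat) :=
  Measure_isSigmaFinite.Build _ _ _ (@lebesgue_tuple d)
    (eq_ind_r (fun m => sigma_finite setT m)
      (sigma_finiteT (projT1 (cid (lebesgue_tuple_measureP d))))
      (projT2 (cid (lebesgue_tuple_measureP d)))).

Lemma lebesgue_tuple_box d (A : 'I_d -> set (measurableTypeR R)) :
  (forall j, measurable (A j)) ->
  lebesgue_tuple [set x : d.-tuple _ | forall j, A j (tnth x j)] =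
    \prod_(j < d) lebesgue_measure (A j).
Proof.
elim: d A => [|d IH] A mA.
  rewrite big_ord0 /= diracE mem_set //; by case.
rewrite big_ord_recl -IH // /lebesgue_tuple -/lebesgue_tuple /pushforward.
rewrite (_ : _ @^-1` _ = A ord0 `*`
    [set x : d.-tuple _ | forall j, A (lift ord0 j) (tnth x j)]).
  rewrite product_measure1E //.
  rewrite (_ : mkset _ = \bigcap_(j in [set: 'I_d])
      ((fun x : d.-tuple _ => tnth x j) @^-1` A (lift ord0 j))).
    apply: fin_bigcap_measurable => // j _.
    by rewrite -[X in measurable X]setTI; apply: measurable_tnth.
  apply/seteqP; split => x /= H j; by [apply: H | move=> _; apply: H | apply: H].
apply/seteqP; split => [[x y] /= H | [x y] /= [H0 H] j].
  split; first exact: (H ord0).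
  by move=> j; have := H (lift ord0 j); rewrite /tuple_of_pair tnthS.
have [->//|] := eqVneq j ord0; rewrite eq_sym => j0.
by have [k -> _] := unlift_some j0; rewrite /tuple_of_pair tnthS; exact: H.
Qed.

End LebesgueTuple.
Arguments lebesgue_tuple {R} d.

Section Discrepancy.
Context (R : realType) (d : nat).

Definition unit_cube : set (d.-tuple R) :=
  [set x | forall j, 0 <= tnth x j <= 1].

Definition anchored_box (x : d.-tuple R) : set (d.-tuple R) :=
  [set y | forall j, 0 <= tnth y j < tnth x j].

Definition discrepancy (s : nat -> d.-tuple R) (N : nat) (x : d.-tuple R) : R :=
  N%:R^-1 * \sum_(k < N) \1_(anchored_box x) (s k) - \prod_(j < d) tnth x j.

Definition Lp_discrepancy (p : R) (s : nat -> d.-tuple R) (N : nat) : \bar R :=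
  ((\int[lebesgue_tuple d]_(x in unit_cube) (`|discrepancy s N x| `^ p)%:E)
    `^ p^-1)%E.
End Discrepancy.

(* Infinite matrices are indexed from 0: [C k l] is the entry in row k + 1 and
   column l + 1. *)
Definition infinite_matrix := nat -> nat -> 'F_2.

Definition column_finite (C : infinite_matrix) : Prop :=
  forall l, exists K : nat, forall k, (K <= k)%N -> C k l = 0.

Definition binary_digit (k l : nat) : 'F_2 := (k %/ 2 ^ l %% 2)%:R.

(* The product of [C] with the digit vector of [k]; since k < 2 ^ k, the digits
   of [k] at positions l >= k vanish and the sum may be truncated there. *)
Definition digital_digit (C : infinite_matrix) (k i : nat) : 'F_2 :=
  \sum_(l < k) C i l * binary_digit k l.

Definition digital_coordinate (R : realType) (C : infinite_matrix) (k : nat) : R :=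
  limn (series (fun i => (nat_of_ord (digital_digit C k i))%:R / 2 ^+ i.+1 : R)).

Definition digital_sequence (R : realType) (d : nat)
    (C : 'I_d -> infinite_matrix) (k : nat) : d.-tuple R :=
  [tuple digital_coordinate R (C j) k | j < d].

(* [I j] lists i_{j,1} > ... > i_{j,nu_j}, shifted by one, so that
   [take alpha (I j)] keeps the min(nu_j, alpha) largest indices.  Intended for
   alpha * n <= q and t <= alpha * n. *)
Definition order_digital_net (alpha t n d q : nat)
    (C : 'I_d -> 'M['F_2]_(q, n)) : Prop :=
  forall I : 'I_d -> seq 'I_q,
    (forall j, sorted (fun a b : 'I_q => (b < a)%N) (I j)) ->
    (\sum_(j < d) \sum_(i <- take alpha (I j)) i.+1 + t <= alpha * n)%N ->
    free [seq row i (C j) | j <- enum 'I_d, i <- I j].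

Definition upper_left (q n : nat) (C : infinite_matrix) : 'M['F_2]_(q, n) :=
  \matrix_(k < q, l < n) C k l.

(* [C] generates an order alpha digital (t,d)-sequence; t < alpha * n is the
   condition n > t / alpha. *)
Definition order_digital_sequence (alpha t d : nat)
    (C : 'I_d -> infinite_matrix) : Prop :=
  (forall j, column_finite (C j)) /\
  forall n : nat, (0 < n)%N -> (t < alpha * n)%N ->
    order_digital_net alpha t (fun j => upper_left (alpha * n) n (C j)).

(* Main.v *)
Require Import Defs.
From HB Require Import structures.
From mathcomp Require Import all_boot all_order all_algebra.
From mathcomp Require Import all_classical all_reals all_analysis.
From mathcomp Require Import measurable_realfun.
From mathcomp Require Import ring lra zify.

Set Implicit Arguments.
Unset Strict Implicit.
Unset Printing Implicit Defensive.

Import Order.TTheory GRing.Theory Num.Theory.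
Import numFieldNormedType.Exports.

Local Open Scope classical_set_scope.
Local Open Scope ring_scope.

(* Let f be N times the discrepancy, rounded to the dyadic grid of step
   2 ^ -L with 2 ^ (L-1) <= N < 2 ^ L; rounding changes it by O(2 ^ t), since a
   dyadic slab of width 2 ^ -L contains at most 2 ^ t of the first N points.
   Split f into its multi-level Haar components f_J, J in {0..L}^d.

   Along each coordinate the f_J are martingale differences, so for even
   exponents 2M the norms in L_{2M} satisfy ||f||^2 <= C sum_J ||f_J||^2; as only
   (L+1)^d components occur, it suffices to show |f_J| <= C 2 ^ t for each J.

   On a dyadic box the J-component of the indicator of [0, x) is a product of
   piecewise linear functions of the coordinates of the point.  Expanding these
   in binary digits writes f_J as a sum over s in N^d of terms of size
   2 ^ -|s|, each a product of functions of single digits involving, in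
   coordinate i, the first J_i digits and one further digit at J_i + s_i.  By the
   order 2 net property these digits are jointly equidistributed on aligned
   index blocks of length 2 ^ n as soon as 2|J| + |s| + t <= 2n.  Complete blocks
   thus contribute exactly the mean, and one incomplete block contributes at most
   O(2 ^ (n - |J| - |s|)) = O(2 ^ t 2 ^ (-|s|/2)), which is summable in s. *)

(** * A moment inequality for dyadic martingales *)

(** Convexity of [u ^ m.+1] with weights J/(J+1) and 1/(J+1) at the points A(J+1)/J and (J+1)B,
    multiplied out so that J = 0 is covered. In the application J counts the levels already
    summed. *)
Lemma convex_exp (R : realFieldType) (A B : R) (J m : nat) : 0 <= A -> 0 <= B ->
  (A + B) ^+ m.+1 * J%:R ^+ m <=
  J.+1%:R ^+ m * (A ^+ m.+1 + J%:R ^+ m * B ^+ m.+1).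
Proof.
move=> A0 B0; have J0 : 0 <= J%:R :> R by [].
elim: m => [|m IH]; first by rewrite !expr0 mul1r mulr1 !expr1 mul1r.
have AB0 : 0 <= (A + B) * J%:R by rewrite mulr_ge0 ?addr_ge0.
rewrite (_ : _ * _ ^+ m.+1 = (A + B) * J%:R * ((A + B) ^+ m.+1 * J%:R ^+ m)); last first.
  by rewrite (exprS (A + B)) (exprS J%:R); ring.
apply: le_trans (ler_wpM2l AB0 IH) _.
rewrite (exprS J.+1%:R) (_ : _ * (J.+1%:R ^+ m * _) =
  J.+1%:R ^+ m * ((A + B) * J%:R * (A ^+ m.+1 + J%:R ^+ m * B ^+ m.+1))); last by ring.
rewrite (_ : _ * J.+1%:R ^+ m * _ = J.+1%:R ^+ m * (J.+1%:R * (A ^+ m.+2 + J%:R ^+ m.+1 * B ^+ m.+2))); last by ring.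
apply: ler_wpM2l; first exact: exprn_ge0.
(* Chebyshev's inequality for [A] and [J * B] *)
have key : 0 <= (A - J%:R * B) * (A ^+ m.+1 - (J%:R * B) ^+ m.+1).
  have [le|/ltW le] := lerP (J%:R * B) A.
    by apply: mulr_ge0; rewrite subr_ge0 // lerXn2r // nnegrE mulr_ge0.
  by apply: mulr_le0; rewrite subr_le0 // lerXn2r // nnegrE mulr_ge0.
rewrite -subr_ge0; apply: le_trans key _.
by rewrite exprMn !exprS -natr1 le_eqVlt; apply/orP; left; apply/eqP; ring.
Qed.

(* The even and odd parts of [(x + y) ^ 2n] are bounded together, by induction
   on n, through [(x +- y) ^ 2 = (x ^ 2 + y ^ 2) +- 2 x y]. *)
Lemma even_odd_power_bound (R : realFieldType) (x y K : R) (n : nat) :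
  (4 * n).+1%:R <= K ->
  let Z := x ^+ 2 + K * y ^+ 2 in
  (x + y) ^+ (2 * n.+1) + (x - y) ^+ (2 * n.+1) <= 2 * Z ^+ n.+1 /\
  `|(x + y) ^+ (2 * n.+1) - (x - y) ^+ (2 * n.+1)| <=
    2 * (n.+1%:R * (`|2 * x * y| * Z ^+ n)).
Proof.
move=> + Z; elim: n => [|n IH] hK.
  rewrite expr0 !expr1 mulr1 mul1r; split; last first.
    by rewrite (_ : _ - _ = 2 * (2 * x * y)) ?normrM ?(ger0_norm (ler0n _ _)); last by ring.
  have y2 := sqr_ge0 y; have : 0 <= (K - 1) * y ^+ 2 by rewrite mulr_ge0 // subr_ge0; lra.
  by rewrite /Z; nra.
have hK' : (4 * n).+1%:R <= K by apply: le_trans hK; rewrite ler_nat; lia.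
have hK1 : 0 <= K - 1 - 4 * n.+1%:R.
  by move: hK; rewrite -natr1 natrM; lra.
have [] := IH hK'.
set P := (x + y) ^+ _; set M := (x - y) ^+ _ => IHs IHd.
rewrite !(mulnS 2 n.+1) !exprD -/P -/M.
have y2 := sqr_ge0 y; have x2 := sqr_ge0 x.
have n0 : 0 <= n.+1%:R :> R by [].
set k := n.+1%:R in IHd hK1 *.
set u := x ^+ 2 + y ^+ 2; set v := 2 * x * y in IHd *.
have u0 : 0 <= u by rewrite addr_ge0.
have uZ : u <= Z.
  have : 0 <= (K - 1) * y ^+ 2 by rewrite mulr_ge0 //; lra.
  by rewrite /u /Z; nra.
have Z0 : 0 <= Z by apply: le_trans uZ.
have ZS : Z ^+ n.+1 = Z * Z ^+ n by rewrite exprS.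
set z := Z ^+ n in IHd ZS *; have z0 : 0 <= z by exact: exprn_ge0.
rewrite (_ : (x + y) ^+ 2 = u + v); last by rewrite /u /v; ring.
rewrite (_ : (x - y) ^+ 2 = u - v); last by rewrite /u /v; ring.
split.
  have e1 : (u + v) * P + (u - v) * M = u * (P + M) + v * (P - M) by ring.
  have e2 : v * (P - M) <= `|v| * (2 * (k * (`|v| * z))).
    by apply: le_trans (ler_norm _) _; rewrite normrM; apply: ler_wpM2l.
  have e3 : u * (P + M) <= u * (2 * (Z * z)) by apply: ler_wpM2l; rewrite -?ZS.
  rewrite e1; apply: le_trans (lerD e3 e2) _.
  rewrite (_ : _ + _ = 2 * (z * (u * Z + k * v ^+ 2))); last by rewrite -(real_normK (num_real v)); ring.
  rewrite !(exprS Z) -/z (_ : 2 * (Z * (Z * z)) = 2 * (z * (Z * Z))); last by ring.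
  apply: ler_wpM2l => //; apply: ler_wpM2l => //.
  (* The difference [Z * Z - (u * Z + k * v ^+ 2)] is the sum of the quantities in [q1] and [q2];
     the first is nonnegative because K is at least 4k + 1. *)
  have q1 : 0 <= x ^+ 2 * (y ^+ 2 * (K - 1 - 4 * k)).
    by apply: mulr_ge0 => //; apply: mulr_ge0.
  have q2 : 0 <= K * (y ^+ 2 * y ^+ 2 * (K - 1)).
    by apply: mulr_ge0; [lra | apply: mulr_ge0; [exact: mulr_ge0 | lra]].
  rewrite -subr_ge0; apply: le_trans (addr_ge0 q1 q2) _.
  by rewrite le_eqVlt; apply/orP; left; apply/eqP; rewrite /u /v /Z; ring.
rewrite (_ : _ - _ = v * (P + M) + u * (P - M)); last by ring.
apply: le_trans (ler_normD _ _) _; rewrite (normrM v) (normrM u) (ger0_norm u0).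
have PM0 : 0 <= P + M by rewrite addr_ge0 // /P /M mulnC exprM sqr_ge0.
rewrite (ger0_norm PM0).
have e1 : `|v| * (P + M) <= `|v| * (2 * (Z * z)) by apply: ler_wpM2l; rewrite -?ZS.
have e2 : u * `|P - M| <= Z * (2 * (k * (`|v| * z))).
  by apply: ler_pM.
apply: le_trans (lerD e1 e2) _; rewrite -(natr1 n.+1) -/k ZS.
by rewrite le_eqVlt; apply/orP; left; apply/eqP; ring.
Qed.

(** Adding both signs of y cancels its odd powers; the even part is bounded by a power of
    [x ^ 2 + (4m+1) y ^ 2], which [convex_exp] splits. This is the step that adds one martingale
    difference y to a partial sum x. *)
Lemma sym_power_bound (R : realFieldType) (x y : R) (m J : nat) :
  (x + y) ^+ (2 * m.+1) * J%:R ^+ m + (x - y) ^+ (2 * m.+1) * J%:R ^+ m <=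
  2 * (J.+1%:R ^+ m * (x ^+ (2 * m.+1) +
     J%:R ^+ m * ((4 * m).+1%:R ^+ m.+1 * y ^+ (2 * m.+1)))).
Proof.
have [h _] := even_odd_power_bound x y (lexx (4 * m).+1%:R).
rewrite -mulrDl; apply: le_trans (ler_wpM2r (exprn_ge0 _ (ler0n _ _)) h) _.
rewrite -mulrA; apply: ler_wpM2l => //.
rewrite (exprM x) (exprM y) -exprMn; apply: convex_exp; first exact: sqr_ge0.
by rewrite mulr_ge0 // sqr_ge0.
Qed.

(* Burkholder's square function inequality in the weak form obtained from it by
   Hoelder; the flip [s l] plays the role of the l-th digit. *)
Lemma martingale_moment (R : realFieldType) (T : finType) (D : nat -> T -> R)
    (s : nat -> T -> T) (m L : nat) :
  (forall l, involutive (s l)) ->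
  (forall l a, (l < L)%N -> D l.+1 (s l a) = - D l.+1 a) ->
  (forall l j a, (l < L)%N -> (j <= l)%N -> D j (s l a) = D j a) ->
  \sum_a (\sum_(j < L.+1) D j a) ^+ (2 * m.+1) <=
  (4 * m).+1%:R ^+ m.+1 * L.+1%:R ^+ m *
    \sum_(j < L.+1) \sum_a D j a ^+ (2 * m.+1).
Proof.
move=> sK; elim: L => [|L IH] Danti Dinv.
  rewrite expr1n mulr1 big_ord_recl big_ord0 addr0.
  under eq_bigr do rewrite big_ord_recl big_ord0 addr0.
  apply: ler_peMl; last by rewrite exprn_ege1 // ler1n.
  by apply: sumr_ge0 => a _; rewrite exprM exprn_ge0 // sqr_ge0.
have {}IH := IH (fun l a h => Danti l a (ltnW h)) (fun l j a h => Dinv l j a (ltnW h)).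
set x := fun a => \sum_(j < L.+1) D j a.
set y := D L.+1.
have xs a : x (s L a) = x a.
  by apply: eq_bigr => j _; apply: Dinv; rewrite // -ltnS.
have ys a : y (s L a) = - y a by apply: Danti.
rewrite [X in _ * X]big_ord_recr /=; under eq_bigr do rewrite big_ord_recr /=.
rewrite -/x -/y -/(y _) in IH *.
set K := (4 * m).+1%:R ^+ m.+1 in IH *.
set S := \sum_(j < L.+1) _ in IH *.
set Y := \sum_a y a ^+ _; set X := \sum_a x a ^+ _ in IH.
have J0 : 0 < L.+1%:R ^+ m :> R by rewrite exprn_gt0.
rewrite -(ler_pM2r J0).
set Q := \sum_a _.
(* The flip permutes T, fixes x and negates y, so averaging the two forms of Q removes the odd
   powers of y. *)
have Q2 : Q = \sum_a (x a - y a) ^+ (2 * m.+1).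
  rewrite /Q (reindex_inj (inv_inj (sK L))) /=.
  by apply: eq_bigr => a _; rewrite -/(x (s L a)) -/(y (s L a)) xs ys.
have step : Q * L.+1%:R ^+ m <= L.+2%:R ^+ m * (X + L.+1%:R ^+ m * (K * Y)).
  have : \sum_a ((x a + y a) ^+ (2 * m.+1) * L.+1%:R ^+ m + (x a - y a) ^+ (2 * m.+1) * L.+1%:R ^+ m) <=
    \sum_a 2 * (L.+2%:R ^+ m * (x a ^+ (2 * m.+1) + L.+1%:R ^+ m * (K * y a ^+ (2 * m.+1)))).
    by apply: ler_sum => a _; apply: sym_power_bound.
  rewrite big_split /= -!mulr_suml -Q2 -!mulr_sumr big_split /= -!mulr_sumr -/X -/Y -/Q.
  by lra.
apply: le_trans step _.
rewrite [X in _ <= X](_ : _ = L.+2%:R ^+ m * (K * L.+1%:R ^+ m * S + L.+1%:R ^+ m * (K * Y))); last by ring.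
by apply: ler_wpM2l; rewrite ?exprn_ge0 // lerD2r.
Qed.

Lemma big_tuple_cons (V : nmodType) (I : finType) (d : nat) (F : d.+1.-tuple I -> V) :
  \sum_v F v = \sum_i \sum_(w : d.-tuple I) F [tuple of i :: w].
Proof.
rewrite pair_big /= (reindex (fun p : I * d.-tuple I => [tuple of p.1 :: p.2])) //=.
exists (fun v => (thead v, [tuple of behead v])) => [[i w] _ | v _] /=.
  by congr pair; apply: val_inj.
by rewrite [RHS]tuple_eta.
Qed.

(** The one-dimensional inequality is applied to the first coordinate, where [F j] gathers all
    components of level j, and the induction hypothesis to each [F j]. Indexing D by [seq nat]
    preserves its type when a first level is fixed. *)
Lemma martingale_moment_multi (R : realFieldType) (T : finType) (m L d : nat)
    (D : seq nat -> T -> R) (s : nat -> nat -> T -> T) :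
  (forall e l, involutive (s e l)) ->
  (forall v e l a, (e < d)%N -> (l < L)%N -> nth 0%N v e = l.+1 ->
     D v (s e l a) = - D v a) ->
  (forall v e l a, (e < d)%N -> (l < L)%N -> (nth 0%N v e <= l)%N ->
     D v (s e l a) = D v a) ->
  \sum_a (\sum_(v : d.-tuple 'I_L.+1) D (map val v) a) ^+ (2 * m.+1) <=
  ((4 * m).+1%:R ^+ m.+1 * L.+1%:R ^+ m) ^+ d *
    \sum_(v : d.-tuple 'I_L.+1) \sum_a D (map val v) a ^+ (2 * m.+1).
Proof.
move=> sK; elim: d D s sK => [|d IH] D s sK Danti Dinv.
  rewrite mul1r exchange_big /=; apply: ler_sum => a _.
  have tE (v : 0.-tuple 'I_L.+1) : v = [tuple] by apply: tuple0.
  by rewrite !(big_pred1 [tuple]) // => v; rewrite (tE v); symmetry; apply: eqxx.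
under eq_bigr do rewrite big_tuple_cons /=.
rewrite [X in _ * X]big_tuple_cons /=.
set F := fun j a => \sum_(w : d.-tuple 'I_L.+1) D (j :: map val w) a.
have Fanti l a : (l < L)%N -> F l.+1 (s 0%N l a) = - F l.+1 a.
  by move=> lL; rewrite /F -sumrN; apply: eq_bigr => w _; apply: Danti.
have Finv l j a : (l < L)%N -> (j <= l)%N -> F j (s 0%N l a) = F j a.
  by move=> lL jl; apply: eq_bigr => w _; apply: Dinv.
apply: le_trans (martingale_moment m (sK 0%N) Fanti Finv) _.
rewrite [X in _ <= X * _]exprS -[X in _ <= X]mulrA; apply: ler_wpM2l.
  by rewrite mulr_ge0 // exprn_ge0.
rewrite mulr_sumr; apply: ler_sum => j _.
apply: (IH (fun v => D (val j :: v)) (fun e => s e.+1)) => //.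
- by move=> v e l a ed lL vl; apply: Danti.
- by move=> v e l a ed lL vl; apply: Dinv.
Qed.

Lemma prod_sum_tuple (R : comPzRingType) (d M : nat) (H : 'I_d -> nat -> R) :
  \prod_(i < d) \sum_(j < M) H i j =
  \sum_(v : d.-tuple 'I_M) \prod_(i < d) H i (nth 0%N (map val v) i).
Proof.
rewrite bigA_distr_bigA /= (reindex (fun v : d.-tuple 'I_M => [ffun i => tnth v i])) /=.
  apply: eq_bigr => v _; apply: eq_bigr => i _.
  by rewrite ffunE (nth_map (tnth v i)) ?size_tuple // -tnth_nth.
exists (fun f => [tuple f i | i < d]) => [v _ | f _].
  by apply: eq_from_tnth => i; rewrite tnth_mktuple ffunE.
by apply/ffunP => i; rewrite ffunE tnth_mktuple.
Qed.

(** * Haar expansion of the lexicographic order *)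

Section Digits.
Variable R : realFieldType.
Implicit Types (a y : nat -> bool).

(* The value of the binary fraction 0.a_0 a_1 ... a_(L-1). *)
Definition bin_val a L : R := \sum_(q < L) (a q)%:R / 2 ^+ q.+1.

(* 1 if y precedes a lexicographically on the first L digits, else 0. *)
Definition lex_lt a y L : R :=
  \sum_(q < L) (~~ y q)%:R * (a q)%:R * \prod_(x < q) (y x == a x)%:R.

(* [\sum_q haar_term J q a y] is the level-J Haar component of
   [a |-> lex_lt a y L], split according to the last digit q of y it uses. *)
Definition haar_factor (J : nat) a (x : nat) (b : bool) : R :=
  (b == a x)%:R - (if x.+1 == J then 2^-1 else 0).

(** For J <= q this is the mean over the digits of [a] from J to q: each comparison with a digit of
    y averages to 1/2, and so does [a q]. Level q + 1 carries the centred digit [a q]. *)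
Definition haar_coef (J q : nat) a : R :=
  if (J <= q)%N then (2 ^+ (q.+1 - J))^-1
  else if J == q.+1 then (a q)%:R - 2^-1 else 0.

Definition haar_term (J q : nat) a y : R :=
  haar_coef J q a * (~~ y q)%:R *
  \prod_(x < minn J q) haar_factor J a x (y x).

(* The average of [haar_term J q a y] over the digits of y. *)
Definition haar_mean (J q : nat) a : R :=
  haar_coef J q a * 2^-1 *
  \prod_(x < minn J q) ((haar_factor J a x false + haar_factor J a x true) / 2).

(** Telescoping: the differences up to level q add up to the conditional mean given the first q
    digits of [a], in which the free digit [a q] counts 1/2. *)
Lemma haar_term_sum a y q :
  \sum_(J < q.+1) (2 ^+ (q.+1 - J))^-1 * \prod_(x < minn J q) haar_factor J a x (y x) =
  2^-1 * \prod_(x < q) (y x == a x)%:R :> R.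
Proof.
elim: q => [|q IH].
  by rewrite big_ord_recl /= subn0 expr1 min0n !big_ord0 addr0.
rewrite big_ord_recr /= minnn subSn // subnn expr1.
have -> : \prod_(x < q.+1) haar_factor q.+1 a x (y x) =
    \prod_(x < q) (y x == a x)%:R * ((y q == a q)%:R - 2^-1) :> R.
  rewrite big_ord_recr /= /haar_factor eqxx; congr (_ * _).
  by apply: eq_bigr => x _; rewrite eqSS ltn_eqF // subr0.
have -> : \sum_(J < q.+1) (2 ^+ (q.+2 - J))^-1 * \prod_(x < minn J q.+1) haar_factor J a x (y x) =
    2^-1 * (\sum_(J < q.+1) (2 ^+ (q.+1 - J))^-1 * \prod_(x < minn J q) haar_factor J a x (y x)) :> R.
  rewrite mulr_sumr; apply: eq_bigr => J _.
  have Jq : (J <= q)%N by rewrite -ltnS.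
  have -> : minn J q.+1 = minn J q by lia.
  by rewrite (subSn (leqW Jq)) exprS invfM mulrA.
by rewrite IH big_ord_recr /=; lra.
Qed.

Lemma haar_coef_gt J q a : (q.+1 < J)%N -> haar_coef J q a = 0.
Proof. by move=> qJ; rewrite /haar_coef leqNgt ltnW // gtn_eqF. Qed.

Lemma sum_levels (F : nat -> R) (L q : nat) : (q < L)%N ->
  (forall J, (q.+1 < J)%N -> F J = 0) ->
  \sum_(J < L.+1) F J = \sum_(J < q.+1) F J + F q.+1.
Proof.
move=> qL F0; rewrite -!(big_mkord xpredT) (@big_cat_nat _ _ _ q.+2) //=.
have -> : \sum_(q.+2 <= J < L.+1) F J = 0.
  by rewrite big_nat_cond big1 // => J; rewrite andbT => /andP[/F0].
by rewrite addr0 (@big_nat_recr _ _ _ q.+1 0).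
Qed.

Lemma lex_lt_haar a y L :
  lex_lt a y L = \sum_(J < L.+1) \sum_(q < L) haar_term J q a y.
Proof.
rewrite exchange_big /=; apply: eq_bigr => q _.
rewrite (@sum_levels (fun J => haar_term J q a y) L q) //; last first.
  by move=> J qJ; rewrite /haar_term haar_coef_gt // !mul0r.
have -> : \sum_(J < q.+1) haar_term J q a y = (~~ y q)%:R *
   \sum_(J < q.+1) (2 ^+ (q.+1 - J))^-1 * \prod_(x < minn J q) haar_factor J a x (y x).
  rewrite mulr_sumr; apply: eq_bigr => J _.
  have Jq : (J <= q)%N by rewrite -ltnS.
  by rewrite /haar_term /haar_coef Jq; ring.
(* Levels up to q contribute the weight 1/2 and level q + 1 the weight [a q - 2^-1]; together they
   give [a q]. *)
rewrite haar_term_sum /haar_term /haar_coef ltnn eqxx (minn_idPr (leqnSn q)).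
have -> : \prod_(x < q) haar_factor q.+1 a x (y x) = \prod_(x < q) (y x == a x)%:R.
  by apply: eq_bigr => x _; rewrite /haar_factor eqSS ltn_eqF // subr0.
by ring.
Qed.

Lemma haar_factor_mean J a x :
  (haar_factor J a x false + haar_factor J a x true) / 2 =
  if x.+1 == J then 0 else 2^-1.
Proof. by rewrite /haar_factor; case: (x.+1 == J); case: (a x) => /=; lra. Qed.

(** A centred factor averages to zero over y, so for each q only the levels 0 and q + 1 survive. *)
Lemma bin_val_haar a L :
  bin_val a L = \sum_(J < L.+1) \sum_(q < L) haar_mean J q a.
Proof.
rewrite exchange_big /=; apply: eq_bigr => q _.
rewrite (@sum_levels (fun J => haar_mean J q a) L q) //; last first.
  by move=> J qJ; rewrite /haar_mean haar_coef_gt // !mul0r.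
rewrite big_ord_recl big1 ?addr0; last first.
  move=> J _; rewrite /haar_mean /= /bump add1n.
  have Jq : (J < q)%N by [].
  by rewrite (minn_idPl Jq) big_ord_recr /= haar_factor_mean eqxx !mulr0.
rewrite /haar_mean /haar_coef ltnn eqxx (minn_idPr (leqnSn q)) min0n big_ord0 /= subn0.
rewrite (eq_bigr (fun=> 2^-1)); last first.
  by move=> x _; rewrite haar_factor_mean eqSS ltn_eqF.
rewrite prodr_const card_ord exprS exprVn; set z := (2 ^+ q)^-1.
by rewrite invfM -/z; lra.
Qed.

Lemma eq_haar_factor J a a' x b : a x = a' x ->
  haar_factor J a x b = haar_factor J a' x b.
Proof. by rewrite /haar_factor => ->. Qed.

Lemma haar_factorN J a a' x b : x.+1 = J -> a x = ~~ a' x ->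
  haar_factor J a x b = - haar_factor J a' x b.
Proof.
by rewrite /haar_factor => -> ->; rewrite eqxx; case: b; case: (a' x) => /=; lra.
Qed.

Lemma haar_eq J q a a' y : (forall x, (x < J)%N -> a x = a' x) ->
  haar_term J q a y = haar_term J q a' y /\ haar_mean J q a = haar_mean J q a'.
Proof.
move=> aa; have cE : haar_coef J q a = haar_coef J q a'.
  by rewrite /haar_coef; case: leqP => // qJ; case: eqP => // E; rewrite aa // E.
have aa' (x : 'I_(minn J q)) : a x = a' x.
  by apply: aa; apply: leq_trans (ltn_ord x) (geq_minl _ _).
rewrite /haar_term /haar_mean cE; split; congr (_ * _); apply: eq_bigr => x _.
  exact: eq_haar_factor.
by rewrite !(eq_haar_factor _ _ (aa' x)).
Qed.

(** Flipping digit l negates the one centred factor if l < q and the coefficient if q = l; for q < l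
    both sides vanish. With [haar_eq] this supplies the martingale difference property. *)
Lemma haar_anti l q a a' y :
  (forall x, (x < l)%N -> a x = a' x) -> a l = ~~ a' l ->
  haar_term l.+1 q a y = - haar_term l.+1 q a' y /\
  haar_mean l.+1 q a = - haar_mean l.+1 q a'.
Proof.
move=> aa al; rewrite /haar_term /haar_mean /haar_coef.
have [lq|ql] := ltnP l q.
  rewrite (minn_idPl lq) !big_ord_recr /=; split.
    rewrite (haar_factorN _ _ al) // !mulrN; congr (- (_ * (_ * _))).
    by apply: eq_bigr => x _; apply: eq_haar_factor; apply: aa.
  by rewrite !haar_factor_mean eqxx !mulr0 oppr0.
rewrite eqSS; case: eqP => [E|_]; last by rewrite !mul0r oppr0.
rewrite -E al (minn_idPr (leqnSn l)).
have -> : (~~ a' l)%:R - 2^-1 = - ((a' l)%:R - 2^-1) :> R.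
  by case: (a' l) => /=; lra.
rewrite !mulNr; split; congr (- (_ * _)); apply: eq_bigr => x _.
  by apply: eq_haar_factor; apply: aa.
by rewrite !haar_factor_mean.
Qed.

Definition haar_abs_mean (J q : nat) a : R :=
  `|haar_coef J q a| * 2^-1 *
  \prod_(x < minn J q) ((`|haar_factor J a x false| + `|haar_factor J a x true|) / 2).

(** Centred or not, every factor has absolute mean 1/2: its two values are 0 and 1, or plus and
    minus 1/2. *)
Lemma haar_abs_mean_le J q a : haar_abs_mean J q a <= (2 ^+ q.+1)^-1.
Proof.
have fE x : (`|haar_factor J a x false| + `|haar_factor J a x true|) / 2 = 2^-1 :> R.
  have n1 : `|1 - 2^-1| = 2^-1 :> R by rewrite ger0_norm; lra.
  have n2 : `|0 - 2^-1| = 2^-1 :> R by rewrite sub0r normrN ger0_norm; lra.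
  rewrite /haar_factor; case: (x.+1 == J); case: (a x) => /=;
    rewrite ?n1 ?n2 ?subr0 ?normr0 ?normr1; lra.
rewrite /haar_abs_mean (eq_bigr (fun=> 2^-1)) => [|x _]; last exact: fE.
rewrite prodr_const card_ord.
rewrite /haar_coef; case: leqP => [Jq|qJ].
  rewrite -{2}(subnK (leqW Jq)) exprD ger0_norm ?invr_ge0 ?exprn_ge0 //.
  rewrite -mulrA invfM exprVn ler_wpM2l ?invr_ge0 ?exprn_ge0 //.
  by rewrite ler_piMl ?invr_ge0 ?exprn_ge0 //; lra.
case: (J == q.+1); last by rewrite normr0 !mul0r invr_ge0 exprn_ge0.
rewrite exprS invfM exprVn ler_wpM2r ?invr_ge0 ?exprn_ge0 //.
apply: ler_piMl; first by lra.
by case: (a q) => /=; rewrite ler_norml; apply/andP; split; lra.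
Qed.

Lemma haar_mean_abs_le J q a : `|haar_mean J q a| <= haar_abs_mean J q a.
Proof.
have h2 : 0 <= 2^-1 :> R by rewrite invr_ge0.
rewrite /haar_mean /haar_abs_mean !normrM normr_prod (ger0_norm h2).
apply: ler_wpM2l; first by rewrite mulr_ge0 ?invr_ge0.
apply: ler_prod => x _; rewrite normr_ge0 /= normrM (ger0_norm h2).
by apply: ler_wpM2r; rewrite ?invr_ge0 ?ler_normD.
Qed.

Lemma haar_term_abs J q a y : `|haar_term J q a y| =
  `|haar_coef J q a| * (~~ y q)%:R * \prod_(x < minn J q) `|haar_factor J a x (y x)|.
Proof. by rewrite /haar_term !normrM normr_prod normr_nat. Qed.

End Digits.

(** * Lexicographic comparison and binary fractions *)

Section Lex.
Variable R : realFieldType.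
Implicit Types (a y : nat -> bool).

Lemma halfS n : (2 ^+ n)^-1 = 2 * (2 ^+ n.+1)^-1 :> R.
Proof. by rewrite exprS invfM mulVKf ?pnatr_eq0. Qed.

(** Distinct grid values differ by at least a full step [2 ^- L], which absorbs the later rounding
    of points; only agreement in all L digits leaves a comparison undecided. *)
Lemma lex_ltP a y L :
  [\/ [/\ lex_lt R a y L = 1, \prod_(x < L) (y x == a x)%:R = 0 :> R &
        bin_val R y L + (2 ^+ L)^-1 <= bin_val R a L],
      [/\ lex_lt R a y L = 0, \prod_(x < L) (y x == a x)%:R = 0 :> R &
        bin_val R a L + (2 ^+ L)^-1 <= bin_val R y L] |
      [/\ lex_lt R a y L = 0, \prod_(x < L) (y x == a x)%:R = 1 :> R &
        bin_val R y L = bin_val R a L]].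
Proof.
elim: L => [|L IH].
  by apply: Or33; rewrite /lex_lt /bin_val !big_ord0.
rewrite /lex_lt /bin_val !big_ord_recr /= -/(lex_lt R a y L) -/(bin_val R a L) -/(bin_val R y L).
have z0 : 0 < (2 ^+ L.+1)^-1 :> R by rewrite invr_gt0 exprn_gt0.
rewrite (halfS L) in IH; set z := (2 ^+ L.+1)^-1 in IH z0 *.
case: IH => -[-> -> h]; [apply: Or31 | apply: Or32 | ].
- by rewrite !mulr0 mul0r addr0; split => //; case: (a L); case: (y L) => /=; lra.
- by rewrite !mulr0 mul0r addr0; split => //; case: (a L); case: (y L) => /=; lra.
rewrite !h; case: (a L); case: (y L); rewrite /= ?mulr0 ?mul0r ?mulr1 ?addr0 ?add0r ?mul1r.
- by apply: Or33.
- by apply: Or31; split => //; lra.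
- by apply: Or32; split => //; lra.
- by apply: Or33.
Qed.

(** The tail is at most a geometric sum; keeping its last term makes the upper bound strict in
    [digital_coordinate_bounds]. *)
Lemma bin_val_tail y L M : (L <= M)%N ->
  bin_val R y L <= bin_val R y M <= bin_val R y L + (2 ^+ L)^-1 - (2 ^+ M)^-1.
Proof.
move=> /subnK <-; elim: (M - L)%N => [|k /andP[IH1 IH2]].
  by rewrite add0n lexx /= addrK.
rewrite addSn /bin_val big_ord_recr /= -/(bin_val R y (k + L)) -/(bin_val R y L).
rewrite (halfS (k + L)) in IH2.
have z0 : 0 < (2 ^+ (k + L).+1)^-1 :> R by rewrite invr_gt0 exprn_gt0.
by apply/andP; split; case: (y (k + L)%N) => /=; lra.
Qed.

Lemma bin_val_ge0 y L : 0 <= bin_val R y L.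
Proof. by apply: sumr_ge0 => q _; rewrite divr_ge0 ?exprn_ge0. Qed.

Lemma eq_bin_val a a' L : (forall q, (q < L)%N -> a q = a' q) ->
  bin_val R a L = bin_val R a' L.
Proof. by move=> aa; apply: eq_bigr => q _; rewrite aa. Qed.

(** Bisection; the cells are closed on both sides so that x = 1 is covered. *)
Lemma bin_val_cover (x : R) L : 0 <= x <= 1 ->
  exists a, bin_val R a L <= x <= bin_val R a L + (2 ^+ L)^-1.
Proof.
move=> x01; elim: L => [|L [a ax]].
  by exists (fun=> false); rewrite /bin_val big_ord0 add0r expr0 invr1.
pose b := bin_val R a L + (2 ^+ L.+1)^-1 < x.
exists (fun q => if q == L then b else a q).
have -> : bin_val R (fun q => if q == L then b else a q) L.+1 =
    bin_val R a L + b%:R / 2 ^+ L.+1.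
  rewrite /bin_val big_ord_recr /= eqxx; congr (_ + _).
  by apply: eq_bigr => q _; rewrite ltn_eqF.
rewrite (halfS L) in ax.
by rewrite /b; case: ltP => h; case/andP: ax => *; apply/andP; split; rewrite /=; lra.
Qed.

End Lex.

(** * Equidistribution of digits on aligned blocks *)

Lemma F2P (x : 'F_2) : x = 0 \/ x = 1.
Proof. by case: x => -[|[|]] // i; [left | right]; apply: val_inj. Qed.

(** Independent rows form a matrix with a right inverse, whose first column is the vector sought. *)
Lemma free_dual (F : fieldType) (n : nat) (x : 'rV[F]_n) (X : seq 'rV[F]_n) :
  free (x :: X) ->
  exists u : 'rV[F]_n, (u *m x^T) 0 0 = 1 /\ forall y, y \in X -> (u *m y^T) 0 0 = 0.
Proof.
move=> f0; have fX := @freeP _ _ _ (in_tuple (x :: X)) f0.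
set M := \matrix_(i < size (x :: X)) (x :: X)`_i.
have /row_freeP[B MB] : row_free M.
  apply: inj_row_free => v; rewrite mulmx_sum_row => v0.
  apply/rowP => i; rewrite mxE; apply: (fX (fun j => v 0 j)).
  by rewrite -[RHS]v0; apply: eq_bigr => j _; rewrite rowK.
have dual (i : 'I_(size (x :: X))) :
    ((col ord0 B)^T *m ((x :: X)`_i)^T) 0 0 = (i == ord0)%:R.
  have <- : (M *m B) i ord0 = (i == ord0)%:R by rewrite MB mxE.
  rewrite -trmx_mul !mxE; apply: eq_bigr => j _; rewrite !mxE.
  by congr (_ * _).
exists (col ord0 B)^T; split; first exact: (dual ord0).
move=> y yX; have yi : (index y X < size X)%N by rewrite index_mem.
have := dual (Ordinal (yi : ((index y X).+1 < size (x :: X))%N)).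
by rewrite /= nth_index.
Qed.

(* A dual vector to the head of W moves the argument of its factor only, so
   averaging over that translation splits the factor off. *)
Lemma sum_prod_free (R : realFieldType) (n : nat) (T : eqType) (W : seq T)
    (psi : T -> 'rV['F_2]_n) (c : T -> 'F_2) (th : T -> 'F_2 -> R) :
  free (map psi W) ->
  \sum_(v : 'rV['F_2]_n) \prod_(w <- W) th w ((v *m (psi w)^T) 0 0 + c w) =
  2 ^+ n * \prod_(w <- W) ((th w 0 + th w 1) / 2).
Proof.
elim: W => [|w W IH] /= fW.
  under eq_bigr do rewrite big_nil.
  rewrite big_nil mulr1 sumr_const card_mx mul1n card_Fp //.
  by rewrite natrX.
have [u [u1 u0]] := free_dual fW.
have {}/IH IH : free (map psi W) by move: fW; rewrite free_cons => /andP[].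
rewrite big_cons mulrCA -IH.
under eq_bigr do rewrite big_cons.
set S := \sum_v _; pose P := fun v : 'rV['F_2]_n => \prod_(w <- W) th w ((v *m (psi w)^T) 0 0 + c w).
have S2 : S = \sum_v th w ((v *m (psi w)^T) 0 0 + c w + 1) * P v.
  rewrite /S (reindex_inj (addIr u)); apply: eq_bigr => v _ /=.
  rewrite mulmxDl mxE u1 addrAC; congr (_ * _).
  rewrite /P big_seq [RHS]big_seq; apply: eq_bigr => w' w'W.
  by rewrite mulmxDl mxE u0 ?addr0 // map_f.
suff : S + S = (th w 0 + th w 1) * \sum_v P v by move=> h; lra.
rewrite {2}S2 /S -big_split /= mulr_sumr; apply: eq_bigr => v _.
rewrite -mulrDl; congr (_ * _).
have [->|->] := F2P ((v *m (psi w)^T) 0 0 + c w); first by rewrite add0r.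
by rewrite addrC (_ : 1 + 1 = 0) //; apply: val_inj.
Qed.

Lemma binary_digit_small k l : (k <= l)%N -> binary_digit k l = 0.
Proof.
move=> kl; rewrite /binary_digit divn_small //.
by apply: leq_trans (ltn_expl k (ltnSn 1)) _; rewrite leq_pexp2l.
Qed.

Lemma digital_digit_widen C k i m : (k <= m)%N ->
  digital_digit C k i = \sum_(l < m) C i l * binary_digit k l.
Proof.
move=> km; rewrite /digital_digit -!(big_mkord xpredT (fun l => C i l * binary_digit k l)).
rewrite [RHS](@big_cat_nat _ _ _ k) //= [X in _ + X]big_nat_cond [X in _ + X]big1 ?addr0 // => l.
by rewrite andbT => /andP[kl _]; rewrite binary_digit_small ?mulr0.
Qed.

Lemma eq_binary n k k' : (k < 2 ^ n)%N -> (k' < 2 ^ n)%N ->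
  (forall l, (l < n)%N -> k %/ 2 ^ l %% 2 = k' %/ 2 ^ l %% 2)%N -> k = k'.
Proof.
elim: n k k' => [|n IH] k k'; first by rewrite !ltnS !leqn0 => /eqP-> /eqP->.
rewrite expnS => kn k'n h.
rewrite (divn_eq k 2) (divn_eq k' 2); congr (_ * _ + _)%N.
  apply: IH; rewrite ?ltn_divLR // 1?mulnC // => l ln.
  by have := h l.+1 ln; rewrite expnS !divnMA.
by have := h 0%N (ltn0Sn n); rewrite expn0 !divn1.
Qed.

Definition digit_vec n (k : 'I_(2 ^ n)) : 'rV['F_2]_n := \row_l binary_digit k l.

Lemma digit_vec_bij n : bijective (@digit_vec n).
Proof.
apply: inj_card_bij; last first.
  by rewrite card_mx mul1n card_Fp // card_ord.
move=> k k' kk'; apply: val_inj; apply: (@eq_binary n (val k) (val k') (ltn_ord k) (ltn_ord k')) => l ln.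
have := congr1 (fun v : 'rV_n => val (v 0 (Ordinal ln))) kk'.
by rewrite !mxE /binary_digit /= !val_Fp_nat // !modn_mod.
Qed.

Lemma binary_digit_block_lo n A k l : (l < n)%N ->
  binary_digit (A * 2 ^ n + k) l = binary_digit k l.
Proof.
move=> ln; rewrite /binary_digit -(subnK ln) addnS expnS expnD mulnCA !mulnA.
by rewrite divnMDl ?expn_gt0 // -mulnA mulnC modnMDl.
Qed.

Lemma binary_digit_block_hi n A k l : (k < 2 ^ n)%N -> (n <= l)%N ->
  binary_digit (A * 2 ^ n + k) l = binary_digit A (l - n).
Proof.
move=> kn nl; rewrite /binary_digit -{1}(subnKC nl) expnD divnMA.
by rewrite divnMDl ?expn_gt0 // (divn_small kn) addn0.
Qed.

(** Inside an aligned block only the lowest n digits of the index vary; the higher ones are those of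
    A and contribute the constant c. Hence each output digit is affine in [digit_vec k]. *)
Lemma digital_digit_block C n A i : exists c : 'F_2, forall k : 'I_(2 ^ n),
  digital_digit C (A * 2 ^ n + k) i =
  (digit_vec k *m (\row_(l < n) C i l)^T) 0 0 + c.
Proof.
exists (\sum_(n <= l < A * 2 ^ n + 2 ^ n + n) C i l * binary_digit A (l - n)) => k.
have kn := ltn_ord k.
rewrite (@digital_digit_widen _ _ _ (A * 2 ^ n + 2 ^ n + n)); last first.
  by apply: leq_trans (leq_addr _ _); rewrite leq_add2l ltnW.
rewrite -(big_mkord xpredT (fun l => C i l * binary_digit (A * 2 ^ n + k) l)).
rewrite (@big_cat_nat _ _ _ n) ?leq_addl //=; congr (_ + _).
  rewrite big_mkord mxE; apply: eq_bigr => l _.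
  by rewrite !mxE binary_digit_block_lo // mulrC.
rewrite big_nat_cond [RHS]big_nat_cond; apply: eq_bigr => l /andP[/andP[nl _] _].
by rewrite binary_digit_block_hi.
Qed.

Definition digit_bit d (E : 'I_d -> infinite_matrix) (j : 'I_d) (k x : nat) : bool :=
  digital_digit (E j) k x != 0.

(** The bound on the sum forces every selected index below 2n, so the rows lie in the submatrix to
    which the net property applies. *)
Lemma order2_free t d (E : 'I_d -> infinite_matrix) n (Q : 'I_d -> seq nat) :
  order_digital_sequence 2 t E -> (0 < n)%N -> (t < 2 * n)%N ->
  (forall j, sorted (fun x y => y < x)%N (Q j)) ->
  (\sum_(j < d) \sum_(x <- take 2 (Q j)) x.+1 + t <= 2 * n)%N ->
  free [seq \row_(l < n) E w.1 w.2 l | w <- [seq (j, x) | j <- enum 'I_d, x <- Q j]].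
Proof.
move=> [_ net] n0 tn srt bnd.
pose I j : seq 'I_(2 * n) := pmap insub (Q j).
have Qlt j x : x \in Q j -> (x < 2 * n)%N.
  case E1 : (Q j) => [//|h s] xs.
  have hx : (x <= h)%N.
    have := srt j; rewrite E1 /= => p.
    have tr : transitive (fun x y : nat => (y < x)%N) by move=> a b c /[swap]; exact: ltn_trans.
    move: xs; rewrite inE => /orP[/eqP->//|xs].
    by have /allP/(_ _ xs)/ltnW := order_path_min tr p.
  apply: leq_ltn_trans hx _; apply: leq_trans bnd; apply: leq_trans (leq_addr _ _).
  by rewrite (bigD1 j) //= E1 /= big_cons -addnA leq_addr.
have Ival j : map val (I j) = Q j.
  rewrite /I (pmap_filter (@insubK _ _ _)); apply/all_filterP/allP => x xQ.
  by rewrite /= isSome_insub (Qlt j).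
have -> : [seq \row_(l < n) E w.1 w.2 l | w <- [seq (j, x) | j <- enum 'I_d, x <- Q j]] =
    [seq row i (upper_left (2 * n) n (E j)) | j <- enum 'I_d, i <- I j].
  rewrite map_allpairs; congr flatten; apply: eq_map => j.
  rewrite -Ival -map_comp; apply: eq_map => i /=.
  by apply/rowP => l; rewrite !mxE.
apply: net => // [j|]; first by have := srt j; rewrite -Ival sorted_map.
apply: leq_trans bnd; rewrite leq_add2r; apply: leq_sum => j _.
by rewrite -Ival -map_take big_map.
Qed.

(** Over a block [digit_vec] runs through the whole space, and independence of the selected rows
    makes the selected digits independent and uniform. Only the two largest indices per coordinate
    enter the cost. *)
Lemma sum_block_prod (R : realFieldType) t d (E : 'I_d -> infinite_matrix) n A
    (Q : 'I_d -> seq nat) (th : 'I_d -> nat -> bool -> R) :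
  order_digital_sequence 2 t E -> (0 < n)%N -> (t < 2 * n)%N ->
  (forall j, sorted (fun x y => y < x)%N (Q j)) ->
  (\sum_(j < d) \sum_(x <- take 2 (Q j)) x.+1 + t <= 2 * n)%N ->
  \sum_(k < 2 ^ n) \prod_(j < d) \prod_(x <- Q j) th j x (digit_bit E j (A * 2 ^ n + k) x) =
  2 ^+ n * \prod_(j < d) \prod_(x <- Q j) ((th j x false + th j x true) / 2).
Proof.
move=> os n0 tn srt bnd.
have fr := order2_free os n0 tn srt bnd.
have [c cE] := boolp.choice (fun w : 'I_d * nat => digital_digit_block (E w.1) n A w.2).
have := sum_prod_free c (fun w b => th w.1 w.2 (b != 0)) fr.
rewrite (reindex (@digit_vec n)) /=; last exact/onW_bij/digit_vec_bij.
rewrite big_allpairs_dep /= big_enum /= => <-.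
apply: eq_bigr => k _; rewrite big_allpairs_dep /= big_enum /=.
apply: eq_bigr => j _; apply: eq_bigr => x _.
by rewrite /digit_bit -(cE (j, x)).
Qed.

(** * Bounds for the Haar components *)

Section Blocks.
Variable R : realFieldType.

Lemma sum_blocks (phi : nat -> R) M A : \sum_(k < A * M) phi k =
  \sum_(B < A) \sum_(k < M) phi (B * M + k)%N.
Proof.
elim: A => [|A IH]; first by rewrite !big_ord0.
by rewrite mulSn addnC big_split_ord /= IH big_ord_recr.
Qed.

Lemma sum_prefix_le (phi : nat -> R) (r M : nat) : (r <= M)%N ->
  (forall k, 0 <= phi k) -> \sum_(k < r) phi k <= \sum_(k < M) phi k.
Proof.
move=> rM phi0; rewrite -(subnKC rM) big_split_ord /= lerDl.
by apply: sumr_ge0.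
Qed.

(** Complete blocks cancel against their mean. For the incomplete block, the partial sum and its
    share of the mean are each at most [M%:R * nu]. *)
Lemma dist_mean_blocks (phi : nat -> R) (mu nu : R) (M N : nat) : (0 < M)%N ->
  (forall A, \sum_(k < M) phi (A * M + k)%N = M%:R * mu) ->
  (forall A, \sum_(k < M) `|phi (A * M + k)%N| = M%:R * nu) ->
  `|mu| <= nu ->
  `|\sum_(k < N) phi k - N%:R * mu| <= 2 * (M%:R * nu).
Proof.
move=> M0 hmu hnu munu; set A := (N %/ M)%N; set r := (N %% M)%N.
have NE : N = (A * M + r)%N := divn_eq N M.
have rM : (r <= M)%N by rewrite ltnW // ltn_mod.
have -> : \sum_(k < N) phi k - N%:R * mu =
    \sum_(k < r) phi (A * M + k)%N - r%:R * mu.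
  rewrite NE big_split_ord /= sum_blocks (eq_bigr (fun=> M%:R * mu)) //.
  by rewrite sumr_const card_ord -mulr_natl natrD natrM; ring.
apply: le_trans (ler_normB _ _) _.
have -> : 2 * (M%:R * nu) = M%:R * nu + M%:R * nu by ring.
apply: lerD.
  apply: le_trans (ler_norm_sum _ _ _) _; rewrite -(hnu A).
  by apply: (@sum_prefix_le (fun k => `|phi (A * M + k)%N|)).
by rewrite normrM normr_nat; apply: ler_pM => //; rewrite ler_nat.
Qed.

Variables (t d : nat) (E : 'I_d -> infinite_matrix).
Hypothesis os : order_digital_sequence 2 t E.

(** Order 2 enters here: the digits used in coordinate i are q and those below min(J, q), so the two
    largest cost at most (q + 1) + J, however many there are. Leaving F general serves both the
    signed and the absolute factors. *)
Lemma sum_block_haar (J q : 'I_d -> nat) (n A : nat) (kap : 'I_d -> R)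
    (F : 'I_d -> nat -> bool -> R) : (0 < n)%N -> (t < 2 * n)%N ->
  (\sum_(i < d) ((q i).+1 + J i) + t <= 2 * n)%N ->
  \sum_(k < 2 ^ n) \prod_(i < d)
     (kap i * (~~ digit_bit E i (A * 2 ^ n + k) (q i))%:R *
      \prod_(x < minn (J i) (q i)) F i x (digit_bit E i (A * 2 ^ n + k) x)) =
  2 ^+ n * \prod_(i < d) (kap i * 2^-1 *
      \prod_(x < minn (J i) (q i)) ((F i x false + F i x true) / 2)).
Proof.
move=> n0 tn bnd.
pose Q i := q i :: rev (iota 0 (minn (J i) (q i))).
pose th i x b := if x == q i then (~~ b)%:R else F i x b : R.
have srt i : sorted (fun x y => y < x)%N (Q i).
  rewrite /Q /= path_min_sorted ?rev_sorted; first exact: iota_ltn_sorted.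
  by apply/allP => x; rewrite mem_rev mem_iota /= add0n leq_min => /andP[].
have bnd2 : (\sum_(i < d) \sum_(x <- take 2 (Q i)) x.+1 + t <= 2 * n)%N.
  apply: leq_trans bnd; rewrite leq_add2r; apply: leq_sum => i _.
  rewrite /Q /= big_cons leq_add2l.
  case: (minn (J i) (q i)) (geq_minl (J i) (q i)) => [|m] mJ.
    by rewrite big_nil.
  by rewrite -[m.+1](addn1 m) iotaD rev_cat /= add0n take0 big_seq1.
have block := sum_block_prod A th os n0 tn srt bnd2.
have split_Q (G : nat -> R) i : \prod_(x <- Q i) G x =
    G (q i) * \prod_(x < minn (J i) (q i)) G x.
  rewrite /Q big_cons; congr (_ * _).
  by rewrite (perm_big _ (permEl (perm_rev _))) -(big_mkord xpredT G) /index_iota subn0.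
have thF i (x : 'I_(minn (J i) (q i))) : th i x =1 F i x.
  by move=> b; rewrite /th ltn_eqF // (leq_trans (ltn_ord x)) // geq_minr.
have hL k : \prod_(i < d)
     (kap i * (~~ digit_bit E i k (q i))%:R *
      \prod_(x < minn (J i) (q i)) F i x (digit_bit E i k x)) =
   \prod_i kap i * \prod_i \prod_(x <- Q i) th i x (digit_bit E i k x).
  rewrite -big_split /=; apply: eq_bigr => i _.
  rewrite (split_Q (fun x => th i x _)) {1}/th eqxx mulrA; congr (_ * _).
  by apply: eq_bigr => x _; rewrite thF.
under eq_bigr do rewrite hL.
rewrite -mulr_sumr block mulrCA; congr (_ * _).
rewrite -big_split /=; apply: eq_bigr => i _.
rewrite (split_Q (fun x => (th i x false + th i x true) / 2)) {1 2}/th eqxx /= addr0 mul1r mulrA.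
by congr (_ * _); apply: eq_bigr => x _; rewrite !thF.
Qed.

(** As 2 <= (3/2)^2, the decay 2^(-S/2) is replaced by the rational power (3/4)^S, which suits a
    geometric series. *)
Lemma pow2_half_le S : 2 ^+ (S %/ 2) <= 2 ^+ S * (3 / 4) ^+ S :> R.
Proof.
rewrite -exprMn {2}(divn_eq S 2) exprD mulnC exprM.
apply: le_trans (_ : (2 * (3 / 4)) ^+ 2 ^+ (S %/ 2) <= _).
  by rewrite lerXn2r ?nnegrE ?exprn_ge0 //; lra.
by apply: ler_peMr; rewrite ?exprn_ge0 ?exprn_ege1 //; lra.
Qed.

Lemma haar_term_dist (J q : 'I_d -> nat) (a : 'I_d -> nat -> bool) (N : nat) :
  (forall i, J i <= (q i).+1)%N ->
  `|\sum_(k < N) \prod_(i < d) haar_term R (J i) (q i) (a i) (digit_bit E i k)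
    - N%:R * \prod_(i < d) haar_mean R (J i) (q i) (a i)| <=
  4 * 2 ^+ t * \prod_(i < d) (3 / 4) ^+ ((q i).+1 - J i).
Proof.
move=> Jq; pose S := (\sum_(i < d) ((q i).+1 - J i))%N.
pose SJ := (\sum_(i < d) J i)%N.
have SE : (\sum_(i < d) (q i).+1 = S + SJ)%N.
  by rewrite -big_split /=; apply: eq_bigr => i _; rewrite subnK.
(* The cost of the digits is S + 2 SJ, and this n satisfies S + 2 SJ + t <= 2n; the successor
   compensates for the rounding of S/2. The incomplete block then costs at most 2 * 2^(n - S - SJ),
   that is 4 * 2^t * 2^(S/2 - S) with S/2 rounded down. *)
pose n := (SJ + t + S %/ 2).+1.
have bnd : (\sum_(i < d) ((q i).+1 + J i) + t <= 2 * n)%N.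
  rewrite big_split /= SE -/SJ /n; lia.
have tn : (t < 2 * n)%N by rewrite /n; lia.
have M0 : (0 < 2 ^ n)%N by rewrite expn_gt0.
pose nu := \prod_(i < d) haar_abs_mean R (J i) (q i) (a i).
pose phi k := \prod_(i < d) haar_term R (J i) (q i) (a i) (digit_bit E i k).
have hmu A : \sum_(k < 2 ^ n) phi (A * 2 ^ n + k)%N =
    (2 ^ n)%:R * \prod_(i < d) haar_mean R (J i) (q i) (a i).
  rewrite natrX /phi /haar_term /haar_mean.
  exact: (sum_block_haar (J := J) A _ (fun i => haar_factor R (J i) (a i)) _ tn bnd).
have hnu A : \sum_(k < 2 ^ n) `|phi (A * 2 ^ n + k)%N| = (2 ^ n)%:R * nu.
  rewrite natrX /nu /haar_abs_mean /phi.
  under eq_bigr do rewrite normr_prod.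
  under eq_bigr do under eq_bigr do rewrite haar_term_abs.
  exact: (sum_block_haar (J := J) A _ (fun i x b => `|haar_factor R (J i) (a i) x b|) _ tn bnd).
have munu : `|\prod_(i < d) haar_mean R (J i) (q i) (a i)| <= nu.
  by rewrite normr_prod; apply: ler_prod => i _; rewrite normr_ge0 haar_mean_abs_le.
apply: le_trans (dist_mean_blocks N M0 hmu hnu munu) _.
have nu_le : nu <= (2 ^+ (S + SJ))^-1.
  rewrite -SE -prodrXr -prodfV; apply: ler_prod => i _.
  by rewrite (le_trans (normr_ge0 _) (haar_mean_abs_le _ _ _ _)) haar_abs_mean_le.
rewrite prodrXr -/S natrX.
apply: le_trans (_ : 2 * (2 ^+ n * (2 ^+ (S + SJ))^-1) <= _).
  by rewrite ler_wpM2l // ler_wpM2l // exprn_ge0.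
rewrite /n exprS !exprD invfM.
set p := 2 ^+ SJ; set u := 2 ^+ t; set h := 2 ^+ (S %/ 2).
have p0 : p != 0 by rewrite expf_neq0 ?pnatr_eq0.
have S0 : 0 < 2 ^+ S :> R by rewrite exprn_gt0.
rewrite [leLHS](_ : _ = 4 * u * (h / 2 ^+ S)); last by field; rewrite p0 gt_eqF.
rewrite ler_wpM2l ?mulr_ge0 ?exprn_ge0 // ler_pdivrMr // mulrC.
exact: pow2_half_le.
Qed.

Lemma geometric_bound (J L : nat) :
  \sum_(q < L) (if (J <= q.+1)%N then (3 / 4) ^+ (q.+1 - J) else 0) <= 4 :> R.
Proof.
(* A sharper bound that passes through the induction; by truncated subtraction its right side is 0
   while L + 1 <= J. *)
have : \sum_(q < L) (if (J <= q.+1)%N then (3 / 4) ^+ (q.+1 - J) else 0) <=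
    4 * (1 - (3 / 4) ^+ (L.+1 - J)) :> R.
  elim: L => [|L IH].
    by rewrite big_ord0 mulr_ge0 // subr_ge0 exprn_ile1 //; lra.
  rewrite big_ord_recr /=; case: leqP => JL.
    apply: le_trans (lerD IH (lexx _)) _.
    by rewrite (subSn JL) exprS; lra.
  have E1 : (L.+2 - J = L.+1 - J)%N by lia.
  by rewrite E1 addr0.
move=> h; apply: le_trans h _.
have : 0 <= (3 / 4) ^+ (L.+1 - J) :> R by rewrite exprn_ge0 //; lra.
lra.
Qed.

Definition level_dist (L N : nat) (J : 'I_d -> nat) (a : 'I_d -> nat -> bool) : R :=
  \sum_(k < N) \prod_(i < d) \sum_(q < L) haar_term R (J i) q (a i) (digit_bit E i k)
    - N%:R * \prod_(i < d) \sum_(q < L) haar_mean R (J i) q (a i).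

(** Both products are expanded over the choices f of a last digit in each coordinate. A choice with
    J_i > f_i + 1 contributes nothing; the bounds for the others factor into d geometric series,
    each at most 4. *)
Lemma level_dist_le L N J a : `|level_dist L N J a| <= 4 * 2 ^+ t * 4 ^+ d.
Proof.
rewrite /level_dist bigA_distr_bigA /=.
under eq_bigr do rewrite bigA_distr_bigA /=.
rewrite exchange_big /= mulr_sumr -sumrB.
pose w (i : 'I_d) (q : 'I_L) : R :=
  if (J i <= q.+1)%N then (3 / 4) ^+ (q.+1 - J i) else 0.
have w0 i q : 0 <= w i q by rewrite /w; case: ifP => // _; rewrite exprn_ge0 //; lra.
apply: le_trans (ler_norm_sum _ _ _) _.
apply: le_trans (_ : \sum_(f : {ffun 'I_d -> 'I_L}) 4 * 2 ^+ t * \prod_(i < d) w i (f i) <= _).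
  apply: ler_sum => f _; have [/forallP h|/forallPn[i]] := boolP [forall i, J i <= (f i).+1]%N.
    have := haar_term_dist a N h.
    rewrite [X in _ <= _ * X -> _](eq_bigr (fun i => w i (f i))) // => i _.
    by rewrite /w h.
  rewrite -ltnNge => fJ.
  rewrite (bigD1 i) //= /haar_mean haar_coef_gt // !mul0r mulr0 subr0 big1 ?normr0.
    by rewrite mulr_ge0 // ?mulr_ge0 ?exprn_ge0 // prodr_ge0.
  by move=> k _; rewrite (bigD1 i) //= /haar_term haar_coef_gt // !mul0r.
rewrite -mulr_sumr -(bigA_distr_bigA (R := R) w) /=.
rewrite ler_wpM2l ?mulr_ge0 ?exprn_ge0 //.
rewrite -[X in _ ^+ X]card_ord -prodr_const; apply: ler_prod => i _.
by rewrite sumr_ge0 //= geometric_bound.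
Qed.

End Blocks.

Lemma prod_opp1 (R : comPzRingType) (I : finType) (F G : I -> R) (e : I) :
  F e = - G e -> (forall i, i != e -> F i = G i) -> \prod_i F i = - \prod_i G i.
Proof.
move=> Fe Fi; rewrite (bigD1 e) //= [in RHS](bigD1 e) //= Fe mulNr.
by congr (- (_ * _)); apply: eq_bigr => i; exact: Fi.
Qed.

Lemma top_two_iota m : (\sum_(x <- take 2 (rev (iota 0 m))) x.+1 <= 2 * m)%N.
Proof.
case: m => [|[|m]]; rewrite ?big_nil ?big_seq1 //.
by rewrite -[m.+2](addn2 m) iotaD rev_cat /= take0 !big_cons big_nil; lia.
Qed.

(** * Moments of the discrepancy on the dyadic grid *)

Section Grid.
Variables (R : realFieldType) (t d : nat) (E : 'I_d -> infinite_matrix).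
Variable (L : nat).

(** Grid points are finite functions so that they can be summed over and flipped; digits from L on
    are zero. *)
Definition grid_digit (a : {ffun 'I_d * 'I_L -> bool}) (i : 'I_d) (q : nat) : bool :=
  if insub q is Some q' then a (i, q') else false.

Definition flip (e l : nat) (a : {ffun 'I_d * 'I_L -> bool}) :=
  [ffun w : 'I_d * 'I_L => a w (+) ((val w.1 == e) && (val w.2 == l))].

Lemma flipK e l : involutive (flip e l).
Proof. by move=> a; apply/ffunP => w; rewrite !ffunE addbK. Qed.

Lemma grid_digit_flip e l a i q : (l < L)%N ->
  grid_digit (flip e l a) i q = grid_digit a i q (+) ((val i == e) && (q == l)).
Proof.
move=> lL; rewrite /grid_digit; case: insubP => [q' _ <-|]; first by rewrite ffunE.
by case: (@eqP _ q l) => [->|_ _]; [rewrite lL | rewrite andbF].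
Qed.

Definition grid_disc (N : nat) (a : {ffun 'I_d * 'I_L -> bool}) : R :=
  \sum_(k < N) \prod_(i < d) lex_lt R (grid_digit a i) (digit_bit E i k) L
  - N%:R * \prod_(i < d) bin_val R (grid_digit a i) L.

Lemma grid_disc_levels N a : grid_disc N a =
  \sum_(v : d.-tuple 'I_L.+1)
    level_dist R E L N (fun i => nth 0%N (map val v) i) (grid_digit a).
Proof.
rewrite /grid_disc /level_dist sumrB exchange_big /= -mulr_sumr.
congr (_ - _ * _).
  apply: eq_bigr => k _.
  rewrite -(prod_sum_tuple _ (fun i J => \sum_(q < L) haar_term R J q (grid_digit a i) (digit_bit E i k))).
  by apply: eq_bigr => i _; rewrite lex_lt_haar.
rewrite -(prod_sum_tuple _ (fun i J => \sum_(q < L) haar_mean R J q (grid_digit a i))).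
by apply: eq_bigr => i _; rewrite bin_val_haar.
Qed.

Hypothesis os : order_digital_sequence 2 t E.

(** [haar_anti] and [haar_eq] give the hypotheses of [martingale_moment_multi]; each of the (L+1)^d
    components is then bounded uniformly over the 2^(dL) grid points. *)
Lemma grid_disc_moment N m :
  \sum_a grid_disc N a ^+ (2 * m.+1) <=
  ((4 * m).+1%:R ^+ m.+1 * L.+1%:R ^+ m) ^+ d *
    (L.+1%:R ^+ d * (2 ^+ (d * L) * (4 * 2 ^+ t * 4 ^+ d) ^+ (2 * m.+1))).
Proof.
pose D v a := level_dist R E L N (fun i => nth 0%N v i) (grid_digit a).
have other e l a (i : 'I_d) q : (l < L)%N -> (i != e :> nat)%N ->
    grid_digit (flip e l a) i q = grid_digit a i q.
  by move=> lL /negPf ie; rewrite grid_digit_flip // ie addbF.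
have Danti v e l a : (e < d)%N -> (l < L)%N -> nth 0%N v e = l.+1 ->
    D v (flip e l a) = - D v a.
  move=> ed lL ve; pose e' := Ordinal ed.
  have lo x : (x < l)%N -> grid_digit (flip e l a) e' x = grid_digit a e' x.
    by move=> xl; rewrite grid_digit_flip // (ltn_eqF xl) andbF addbF.
  have hi : grid_digit (flip e l a) e' l = ~~ grid_digit a e' l.
    by rewrite grid_digit_flip // !eqxx addbT.
  have cE k : \prod_(i < d) \sum_(q < L) haar_term R (nth 0%N v i) q (grid_digit (flip e l a) i) (digit_bit E i k) =
      - \prod_(i < d) \sum_(q < L) haar_term R (nth 0%N v i) q (grid_digit a i) (digit_bit E i k).
    apply: (prod_opp1 (e := e')) => [|i ie]; rewrite ?ve -?sumrN; apply: eq_bigr => q _.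
      by rewrite (haar_anti _ _ _ lo hi).1.
    by rewrite (haar_eq R _ _ (fun x _ => other e l a i x lL ie)).1.
  have mE : \prod_(i < d) \sum_(q < L) haar_mean R (nth 0%N v i) q (grid_digit (flip e l a) i) =
      - \prod_(i < d) \sum_(q < L) haar_mean R (nth 0%N v i) q (grid_digit a i).
    apply: (prod_opp1 (e := e')) => [|i ie]; rewrite ?ve -?sumrN; apply: eq_bigr => q _.
      by rewrite (haar_anti _ _ (fun=> true) lo hi).2.
    by rewrite (haar_eq R _ (fun=> true) (fun x _ => other e l a i x lL ie)).2.
  by rewrite /D /level_dist mE mulrN opprD -sumrN (eq_bigr _ (fun (k : 'I_N) _ => cE k)).
have Dinv v e l a : (e < d)%N -> (l < L)%N -> (nth 0%N v e <= l)%N ->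
    D v (flip e l a) = D v a.
  move=> ed lL ve; have same (i : 'I_d) x : (x < nth 0%N v i)%N ->
      grid_digit (flip e l a) i x = grid_digit a i x.
    move=> xv; have [ie|] := eqVneq (i : nat) e; last exact: other.
    rewrite grid_digit_flip // [x == l]ltn_eqF ?andbF ?addbF //.
    by apply: leq_trans ve; rewrite -ie.
  rewrite /D /level_dist; congr (_ - _ * _).
    apply: eq_bigr => k _; apply: eq_bigr => i _; apply: eq_bigr => q _.
    by rewrite (haar_eq R _ _ (same i)).1.
  apply: eq_bigr => i _; apply: eq_bigr => q _.
  by rewrite (haar_eq R _ (fun=> true) (same i)).2.
under eq_bigr do rewrite grid_disc_levels.
apply: le_trans (martingale_moment_multi m flipK Danti Dinv) _.
rewrite ler_wpM2l ?exprn_ge0 ?mulr_ge0 ?exprn_ge0 //.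
set B := 4 * 2 ^+ t * 4 ^+ d.
have DB v a : D v a ^+ (2 * m.+1) <= B ^+ (2 * m.+1).
  rewrite !(exprM _ 2) lerXn2r ?nnegrE ?sqr_ge0 // -(real_normK (num_real (D v a))).
  by rewrite lerXn2r ?nnegrE ?mulr_ge0 ?exprn_ge0 // level_dist_le.
apply: le_trans (_ : \sum_(v : d.-tuple 'I_L.+1)
    \sum_(a : {ffun 'I_d * 'I_L -> bool}) B ^+ (2 * m.+1) <= _).
  by apply: ler_sum => v _; apply: ler_sum => a _; apply: DB.
rewrite !sumr_const !card_tuple card_ffun card_bool card_prod !card_ord.
by rewrite -[leLHS]mulr_natl -(mulr_natl (B ^+ _)) !natrX.
Qed.

(** The first N indices are extended to a block of length 2^(L+t), where the first L digits are
    equidistributed and exactly 2^t indices match b. *)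
Lemma slab_count (i : 'I_d) (b : nat -> bool) N : (0 < L)%N -> (N <= 2 ^ L)%N ->
  \sum_(k < N) \prod_(q < L) (digit_bit E i k q == b q)%:R <= 2 ^+ t :> R.
Proof.
move=> L0 NL; pose n := (L + t)%N.
pose Q j := if j == i then rev (iota 0 L) else [::].
have srt j : sorted (fun x y => y < x)%N (Q j).
  by rewrite /Q; case: eqP => // _; rewrite rev_sorted; exact: iota_ltn_sorted.
have bnd : (\sum_(j < d) \sum_(x <- take 2 (Q j)) x.+1 + t <= 2 * n)%N.
  rewrite (bigD1 i) //= [X in (_ + X + _)%N]big1 => [|j /negPf ji]; last first.
    by rewrite /Q ji big_nil.
  by rewrite /Q eqxx addn0 /n mulnDr leq_add ?top_two_iota // mul2n -addnn leq_addr.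
have n0 : (0 < n)%N by rewrite /n; lia.
have tn : (t < 2 * n)%N by rewrite /n; lia.
pose phi k : R := \prod_(q < L) (digit_bit E i k q == b q)%:R.
have := sum_block_prod 0 (fun _ x c => (c == b x)%:R : R) os n0 tn srt bnd.
have split_Q (G : 'I_d -> nat -> R) : \prod_(j < d) \prod_(x <- Q j) G j x = \prod_(q < L) G i q.
  rewrite (bigD1 i) //= [X in _ * X]big1 => [|j /negPf ji]; last by rewrite /Q ji big_nil.
  rewrite mulr1 /Q eqxx (perm_big _ (permEl (perm_rev _))).
  by rewrite -(big_mkord xpredT (G i)) /index_iota subn0.
rewrite (split_Q (fun j x => ((false == b x)%:R + (true == b x)%:R) / 2)).
under eq_bigr do rewrite split_Q.
have -> : \prod_(q < L) (((false == b q)%:R + (true == b q)%:R) / 2) = (2 ^+ L)^-1 :> R.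
  rewrite -exprVn -[X in _ ^+ X]card_ord -prodr_const; apply: eq_bigr => q _.
  by case: (b q); rewrite /= ?addr0 ?add0r mul1r.
rewrite /n exprD mulrC mulKf ?expf_neq0 ?pnatr_eq0 // => <-.
under [leRHS]eq_bigr do rewrite mul0n add0n.
apply: (@sum_prefix_le _ phi).
  by apply: leq_trans NL _; rewrite leq_pexp2l // leq_addr.
by move=> k; rewrite prodr_ge0.
Qed.

End Grid.

(** * From the grid to the cube *)

(** Factors are exchanged one at a time, the remaining ones being at most 1. *)
Lemma prod_diff_bound (R : realFieldType) (I : Type) (s : seq I) (l c : I -> R) :
  (forall i, 0 <= l i) -> (forall i, l i <= c i) -> (forall i, c i <= 1) ->
  0 <= \prod_(i <- s) c i - \prod_(i <- s) l i <= \sum_(i <- s) (c i - l i).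
Proof.
move=> l0 lc c1; elim: s => [|i s IH]; first by rewrite !big_nil subrr lexx.
rewrite !big_cons.
have P0 : 0 <= \prod_(j <- s) l j by apply: prodr_ge0.
have P1 : \prod_(j <- s) l j <= 1.
  by apply: prodr_ile1 => j _; rewrite l0 (le_trans (lc j)).
set C := \prod_(j <- s) c j in IH *; set P := \prod_(j <- s) l j in IH P0 P1 *.
set S := \sum_(j <- s) _ in IH *.
have -> : c i * C - l i * P = c i * (C - P) + (c i - l i) * P by ring.
have /andP[h1 h2] := IH; have li := lc i; have ci1 := c1 i.
have ci0 : 0 <= c i by apply: le_trans (lc i).
have d0 : 0 <= c i - l i by rewrite subr_ge0.
rewrite addr_ge0 ?mulr_ge0 //= addrC lerD // ?ler_piMr //.
by apply: le_trans h2; apply: ler_piMl.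
Qed.

Section Pointwise.
Variables (R : realType) (t d : nat) (E : 'I_d -> infinite_matrix).
Hypothesis os : order_digital_sequence 2 t E.
Hypothesis E0 : forall (i : 'I_d) (k l : nat), (2 * l.+1 < k.+1)%N -> E i k l = 0.

(** Index k involves only the first k columns, which vanish beyond row 2k; so every coordinate is a
    finite binary fraction. *)
Lemma digital_digit_eq0 i k x : (2 * k <= x)%N -> digital_digit (E i) k x = 0.
Proof.
move=> kx; apply: big1 => l _; rewrite E0 ?mul0r //.
have := ltn_ord l; lia.
Qed.

Lemma digital_coordinateE i k M : (2 * k <= M)%N ->
  digital_coordinate R (E i) k = bin_val R (digit_bit E i k) M.
Proof.
move=> kM; apply: cvg_lim => //; apply: cvg_near_cst; exists M => // m /= Mm.
rewrite /series /= (@big_cat_nat _ _ _ M) //= [X in _ + X]big_nat_cond.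
rewrite [X in _ + X]big1 => [|x]; last first.
  rewrite andbT => /andP[Mx _].
  by rewrite digital_digit_eq0 ?mul0r // (leq_trans kM).
rewrite addr0 big_mkord; apply: eq_bigr => x _; rewrite /digit_bit.
by congr (_ / _); have [->|->] := F2P (digital_digit (E i) k x).
Qed.

Lemma digital_coordinate_bounds i k L :
  bin_val R (digit_bit E i k) L <= digital_coordinate R (E i) k <
  bin_val R (digit_bit E i k) L + (2 ^+ L)^-1.
Proof.
rewrite (@digital_coordinateE i k (maxn L (2 * k))) ?leq_maxr //.
have /andP[-> h] := bin_val_tail R (digit_bit E i k) (leq_maxl L (2 * k)).
by apply: le_lt_trans h _; rewrite ltrBlDr ltrDl invr_gt0 exprn_gt0.
Qed.

Variables (L N : nat).
Hypotheses (L0 : (0 < L)%N) (NL : (N <= 2 ^ L)%N).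

(** Rounding alters the counting sum by at most d 2^t ([A1]) and the volume term by at most d ([A2],
    using N <= 2^L). *)
Lemma grid_disc_dist (a : {ffun 'I_d * 'I_L -> bool}) (x : d.-tuple R) :
  (forall i, bin_val R (grid_digit a i) L <= tnth x i <=
             bin_val R (grid_digit a i) L + (2 ^+ L)^-1) ->
  (forall i, tnth x i <= 1) ->
  `|\sum_(k < N) \1_(anchored_box x) (digital_sequence R E k)
    - N%:R * \prod_(i < d) tnth x i - grid_disc R E N a| <= 2 * d%:R * 2 ^+ t.
Proof.
move=> xa x1.
pose c k i : R := (digital_coordinate R (E i) k < tnth x i)%R%:R.
pose l k i := lex_lt R (grid_digit a i) (digit_bit E i k) L.
pose g k i : R := \prod_(q < L) (digit_bit E i k q == grid_digit a i q)%:R.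
have cE k : \1_(anchored_box x) (digital_sequence R E k) = \prod_(i < d) c k i.
  have z0 i : 0 <= digital_coordinate R (E i) k.
    by have /andP[h _] := digital_coordinate_bounds i k L; rewrite (le_trans _ h) ?bin_val_ge0.
  rewrite indicE; have [h|h] := boolP [forall i, digital_coordinate R (E i) k < tnth x i].
    rewrite mem_set; last first.
      by move=> i; rewrite tnth_mktuple z0 /=; move/forallP: h.
    by rewrite big1 // => i _; rewrite /c (forallP h).
  rewrite memNset; last first.
    move=> hx; case/negP: h; apply/forallP => i.
    by have := hx i; rewrite tnth_mktuple => /andP[].
  have /forallPn[i /negPf hi] := h.
  by rewrite (bigD1 i) //= /c hi mul0r.
(* Rounding can only lose a point, and only if its coordinate shares the slab of x, that is, all L
   digits agree. *)
have lc k i : 0 <= l k i /\ l k i <= c k i /\ c k i - l k i <= g k i.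
  have /andP[z1 z2] := digital_coordinate_bounds i k L.
  have /andP[x0 x2] := xa i.
  have c01 : 0 <= c k i <= 1 by rewrite /c; case: (_ < _); rewrite /= ?lexx ?ler01.
  rewrite /l /g; case: (lex_ltP R (grid_digit a i) (digit_bit E i k) L) => -[-> -> h].
  - have -> : c k i = 1 by rewrite /c (_ : _ < _ = true) //; apply/idP; lra.
    by rewrite subrr.
  - have -> : c k i = 0.
      by rewrite /c (_ : _ < _ = false) //; apply/negbTE; rewrite -leNgt; lra.
    by rewrite subrr.
  - by rewrite subr0; case/andP: c01.
have c1 k i : c k i <= 1 by rewrite /c; case: (_ < _); rewrite ?ler01.
have A1 : 0 <= \sum_(k < N) (\prod_(i < d) c k i - \prod_(i < d) l k i) <= d%:R * 2 ^+ t.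
  apply/andP; split.
    apply: sumr_ge0 => k _.
    have /andP[//] := prod_diff_bound (index_enum 'I_d) (fun i => (lc k i).1) (fun i => (lc k i).2.1) (c1 k).
  apply: le_trans (_ : \sum_(k < N) \sum_(i < d) g k i <= _).
    apply: ler_sum => k _.
    have /andP[_ h] := prod_diff_bound (index_enum 'I_d) (fun i => (lc k i).1) (fun i => (lc k i).2.1) (c1 k).
    by apply: le_trans h _; apply: ler_sum => i _; have [_ []] := lc k i.
  rewrite exchange_big /=; apply: le_trans (_ : \sum_(i < d) 2 ^+ t <= _).
    by apply: ler_sum => i _; exact: (slab_count R os i (grid_digit a i) L0 NL).
  by rewrite sumr_const card_ord mulr_natl.
have A2 : 0 <= N%:R * (\prod_(i < d) tnth x i - \prod_(i < d) bin_val R (grid_digit a i) L) <= d%:R.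
  have /andP[h1 h2] := @prod_diff_bound R _ (index_enum 'I_d)
    (fun i => bin_val R (grid_digit a i) L) (fun i => tnth x i) (fun i => bin_val_ge0 _ _ _) (fun i => proj1 (andP (xa i))) x1.
  rewrite mulr_ge0 //=.
  apply: le_trans (ler_wpM2l (ler0n _ _) h2) _.
  apply: le_trans (_ : N%:R * (\sum_(i < d) (2 ^+ L)^-1) <= _).
    apply: ler_wpM2l => //; apply: ler_sum => i _.
    by rewrite lerBlDl; case/andP: (xa i).
  rewrite sumr_const card_ord -[_^-1 *+ _]mulr_natl mulrCA ler_piMr // ler_pdivrMr ?exprn_gt0 //.
  by rewrite mul1r -natrX ler_nat.
under eq_bigr do rewrite cE.
rewrite /grid_disc.
have -> : \sum_(k < N) \prod_(i < d) c k i - N%:R * \prod_(i < d) tnth x i -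
   (\sum_(k < N) \prod_(i < d) lex_lt R (grid_digit a i) (digit_bit E i k) L - N%:R * \prod_(i < d) bin_val R (grid_digit a i) L) =
   \sum_(k < N) (\prod_(i < d) c k i - \prod_(i < d) l k i) -
   N%:R * (\prod_(i < d) tnth x i - \prod_(i < d) bin_val R (grid_digit a i) L).
  by rewrite sumrB mulrBr; ring.
have t1 : 1 <= 2 ^+ t :> R by rewrite exprn_ege1 // ler1n.
have dt : d%:R <= d%:R * 2 ^+ t :> R by rewrite ler_peMr.
by rewrite ler_norml; case/andP: A1 => *; case/andP: A2 => *; apply/andP; split; lra.
Qed.

Lemma grid_cell_cover (x : d.-tuple R) : unit_cube x ->
  exists a : {ffun 'I_d * 'I_L -> bool},
    forall i, bin_val R (grid_digit a i) L <= tnth x i <=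
              bin_val R (grid_digit a i) L + (2 ^+ L)^-1.
Proof.
move=> xc; have [b bx] := boolp.choice (fun i => bin_val_cover L (xc i)).
exists [ffun w : 'I_d * 'I_L => b w.1 w.2] => i.
rewrite (@eq_bin_val R _ (b i)) // => q qL.
by rewrite /grid_digit insubT ffunE.
Qed.

End Pointwise.

(** * Integration over the unit cube, cell by cell *)

Section Integration.
Variables (R : realType) (d : nat).

Lemma measurable_box (A : 'I_d -> set (measurableTypeR R)) :
  (forall j, measurable (A j)) ->
  measurable [set x : d.-tuple (measurableTypeR R) | forall j, A j (tnth x j)].
Proof.
move=> mA; rewrite (_ : mkset _ = \bigcap_(j in [set: 'I_d])
    ((fun x : d.-tuple _ => tnth x j) @^-1` A j)).
  apply: fin_bigcap_measurable => // j _.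
  by rewrite -[X in measurable X]setTI; apply: measurable_tnth.
by apply/seteqP; split => x /= H j; [move=> _|]; apply: H.
Qed.

Lemma measurable_unit_cube :
  measurable (@unit_cube R d : set (d.-tuple (measurableTypeR R))).
Proof.
rewrite (_ : @unit_cube R d = [set x : d.-tuple (measurableTypeR R) |
    forall j, `[0, 1]%classic (tnth x j)]).
  by apply: (@measurable_box (fun=> `[0, 1]%classic)) => j; exact: measurable_itv.
by apply/seteqP; split => x /= H j; have := H j; rewrite /= in_itv.
Qed.

Lemma measurable_discrepancy (s : nat -> d.-tuple R) (N : nat) :
  measurable_fun [set: d.-tuple (measurableTypeR R)]
    (discrepancy s N : d.-tuple (measurableTypeR R) -> measurableTypeR R).
Proof.
apply: measurable_funB; last first.
  by apply: measurable_prod => j _; exact: measurable_tnth.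
apply: measurable_funM; first exact: measurable_cst.
apply: measurable_sum => k.
(* For fixed [s k] this is, in x, the indicator of a product of open half-lines, empty if some
   coordinate of [s k] is negative. *)
rewrite (_ : (fun x => _) = \1_[set x : d.-tuple (measurableTypeR R) |
    forall j, [set z : measurableTypeR R | 0 <= tnth (s k) j < z] (tnth x j)]).
  apply: measurable_indic.
  apply: (@measurable_box (fun j => [set z | 0 <= tnth (s k) j < z])) => j.
  have [y0|y0] := boolP (0 <= tnth (s k) j).
    rewrite (_ : mkset _ = `]tnth (s k) j, +oo[%classic); first exact: measurable_itv.
    by apply/seteqP; split => z /=; rewrite in_itv /= andbT.
  rewrite (_ : mkset _ = set0) //.
  by apply/seteqP; split => z //=.
by apply/funext => x; rewrite !indicE.
Qed.

Lemma cell_measure (v : 'I_d -> R) (e : R) : 0 <= e ->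
  lebesgue_tuple d [set x : d.-tuple (measurableTypeR R) |
    forall j, `[v j, v j + e]%classic (tnth x j)] = (e ^+ d)%:E.
Proof.
move=> e0; rewrite (@lebesgue_tuple_box R d (fun j => `[v j, v j + e]%classic)) => [|j]; last exact: measurable_itv.
rewrite (eq_bigr (fun=> e%:E)) => [|j _]; last first.
  rewrite lebesgue_measure_itv /= lte_fin ltrDl; case: ltP => e0'.
    by rewrite -EFinB addrAC subrr add0r.
  by congr EFin; apply: le_anti; rewrite e0 e0'.
by rewrite prodEFin prodr_const card_ord.
Qed.

(** At each x, h is dominated by the sum of G over all cells containing x; overlaps only enlarge
    this bound. *)
Lemma integral_cells_le (I : finType) (v : I -> 'I_d -> R) (e : R) (G : I -> R)
    (h : d.-tuple R -> R) : 0 <= e ->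
  (forall a, 0 <= G a) -> (forall x, 0 <= h x) ->
  measurable_fun [set: d.-tuple (measurableTypeR R)]
    (h : d.-tuple (measurableTypeR R) -> measurableTypeR R) ->
  (forall x, unit_cube x -> exists2 a,
     forall j, v a j <= tnth x j <= v a j + e & h x <= G a) ->
  (\int[lebesgue_tuple d]_(x in @unit_cube R d) (h x)%:E <=
    (\sum_a G a * e ^+ d)%:E)%E.
Proof.
move=> e0 G0 h0 mh cover.
pose cell a : set (d.-tuple (measurableTypeR R)) :=
  [set x | forall j, `[v a j, v a j + e]%classic (tnth x j)].
have mcell a : measurable (cell a).
  by apply: (@measurable_box (fun j => `[v a j, v a j + e]%classic)) => j; exact: measurable_itv.
have mcube := measurable_unit_cube.
have mG a : measurable_fun (@unit_cube R d : set (d.-tuple (measurableTypeR R)))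
    (fun x => (G a)%:E * (\1_(cell a) x)%:E)%E.
  apply/measurable_EFinP => /=; apply: measurable_funM; first exact: measurable_cst.
  exact: measurable_indic.
have G0' a (x : d.-tuple (measurableTypeR R)) : (0 <= (G a)%:E * (\1_(cell a) x)%:E)%E.
  by rewrite mule_ge0 // lee_fin.
apply: (@le_trans _ _ (\int[lebesgue_tuple d]_(x in @unit_cube R d)
    (\sum_a (G a)%:E * (\1_(cell a) x)%:E))%E).
  apply: ge0_le_integral => //.
  - by move=> x _; rewrite lee_fin.
  - by apply/measurable_EFinP; apply: measurable_funTS.
  - by apply: emeasurable_sum.
  - move=> x /cover[a xa hx]; rewrite (bigD1 a) //= indicE mem_set; last first.
      by move=> j /=; rewrite in_itv /= xa.
    rewrite mule1; apply: le_trans (_ : (G a)%:E <= _)%E; first by rewrite lee_fin.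
    by rewrite leeDl // sume_ge0.
rewrite ge0_integral_sum // -sumEFin; apply: lee_sum => a _.
rewrite ge0_integralZl_EFin //; last first.
  by apply/measurable_EFinP; exact: measurable_indic.
rewrite EFinM; apply: lee_wpmul2l; first by rewrite lee_fin.
rewrite integral_indic //.
rewrite -(cell_measure (v a) e0); apply: le_measure; rewrite ?inE //.
- exact: measurableI.
- exact: mcell.
Qed.

End Integration.

(** Passes from a real exponent to an even integer one, where the moment inequality applies. *)
Lemma powR_le1D (R : realType) (u p : R) (M : nat) : 0 <= u -> 0 <= p -> p <= M%:R ->
  u `^ p <= 1 + u ^+ M.
Proof.
move=> u0 p0 pM; have [u1|/ltW u1] := leP u 1.
  apply: le_trans (_ : 1 <= _); last by rewrite lerDl exprn_ge0.
  apply: le_trans (_ : 1 `^ p <= _); last by rewrite powR1.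
  by rewrite ge0_ler_powR ?nnegrE.
apply: le_trans (_ : u ^+ M <= _); last by rewrite lerDr.
by rewrite -powR_mulrn // ler_powR.
Qed.

Lemma exprD_le (R : realFieldType) (u v : R) (M : nat) :
  `|u + v| ^+ M <= 2 ^+ M * (`|u| ^+ M + `|v| ^+ M).
Proof.
wlog uv : u v / `|u| <= `|v| => [h|].
  by have [/h//|/ltW/h] := leP `|u| `|v|; rewrite addrC [X in _ * X]addrC.
apply: le_trans (_ : (2 * `|v|) ^+ M <= _).
  rewrite lerXn2r ?nnegrE ?mulr_ge0 //.
  by apply: le_trans (ler_normD _ _) _; lra.
by rewrite exprMn ler_wpM2l ?exprn_ge0 // lerDr exprn_ge0.
Qed.

(** * The L_p bound at a fixed grid resolution *)

Section Discrepancy_Lp.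
Variables (R : realType) (t d : nat) (E : 'I_d -> infinite_matrix).
Hypothesis os : order_digital_sequence 2 t E.
Hypothesis E0 : forall (i : 'I_d) (k l : nat), (2 * l.+1 < k.+1)%N -> E i k l = 0.

(** The leading 1 comes from [powR_le1D], the power of 2 from [exprD_le], and the two summands from
    the grid moment and from rounding. *)
Definition moment_const (m : nat) : R :=
  1 + 2 ^+ (2 * m.+1) * (((4 * m).+1%:R ^+ m.+1) ^+ d * (4 * 4 ^+ d) ^+ (2 * m.+1)
     + (2 * d%:R) ^+ (2 * m.+1)).

Lemma moment_const_ge1 m : 1 <= moment_const m.
Proof.
by rewrite lerDl mulr_ge0 ?addr_ge0 ?mulr_ge0 ?exprn_ge0 // mulr_ge0 // exprn_ge0.
Qed.

Lemma Lp_discrepancy_le (p : R) (m L N : nat) : (0 < L)%N -> (0 < N)%N -> (N <= 2 ^ L)%N ->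
  1 <= p -> p <= (2 * m.+1)%:R ->
  (Lp_discrepancy p (digital_sequence R E) N <=
    (2 ^+ t * Num.sqrt (L.+1%:R ^+ d) / N%:R * moment_const m)%:E)%E.
Proof.
move=> L0 N0 NL p1 pm; set M := (2 * m.+1)%N in pm *.
set s := digital_sequence R E.
have p0 : 0 <= p by apply: le_trans p1.
have NR : 0 < N%:R :> R by rewrite ltr0n.
(* The expected size of N times the discrepancy; dividing by T leaves quantities bounded in terms of
   d and m. *)
set T : R := 2 ^+ t * Num.sqrt (L.+1%:R ^+ d).
have sq1 : 1 <= Num.sqrt (L.+1%:R ^+ d) :> R.
  by rewrite -[leLHS]sqrtr1 ler_wsqrtr // exprn_ege1 // ler1n.
have t0 : 0 < 2 ^+ t :> R by rewrite exprn_gt0.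
have tT : 2 ^+ t <= T by rewrite ler_peMr // ltW.
have T0 : 0 < T by apply: lt_le_trans tT.
pose f (a : {ffun 'I_d * 'I_L -> bool}) : R := grid_disc R E N a.
pose H (a : {ffun 'I_d * 'I_L -> bool}) : R := 1 + 2 ^+ M * ((`|f a| / T) ^+ M + (2 * d%:R) ^+ M).
pose e : R := (2 ^+ L)^-1.
have e0 : 0 <= e by rewrite invr_ge0 exprn_ge0.
have TN0 : 0 <= T / N%:R by rewrite divr_ge0 // ltW.
have pw x (a : {ffun 'I_d * 'I_L -> bool}) : (forall i, bin_val R (grid_digit a i) L <= tnth x i <=
             bin_val R (grid_digit a i) L + e) -> (forall i, tnth x i <= 1) ->
    `|discrepancy s N x| `^ p <= (T / N%:R) `^ p * H a.
  move=> xa x1; have h := grid_disc_dist os E0 L0 NL xa x1.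
  set S : R := \sum_(k < N) _ - _ in h.
  have -> : discrepancy s N x = T / N%:R * (S / T).
    rewrite /discrepancy /S -/s; field.
    by rewrite !gt_eqF.
  rewrite normrM (ger0_norm TN0) (powRM p TN0 (normr_ge0 _)).
  apply: ler_wpM2l; first exact: powR_ge0.
  apply: le_trans (powR_le1D (normr_ge0 _) p0 pm) _.
  rewrite lerD2l.
  have -> : S / T = f a / T + (S - f a) / T by rewrite -mulrDl; congr (_ / _); ring.
  apply: le_trans (exprD_le _ _ _) _.
  apply: ler_wpM2l; first exact: exprn_ge0.
  rewrite !normrM (ger0_norm (ltW (_ : 0 < T^-1))) ?invr_gt0 // lerD2l.
  rewrite lerXn2r ?nnegrE ?mulr_ge0 ?invr_ge0 ?(ltW T0) // ler_pdivrMr //.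
  apply: le_trans h _.
  by rewrite ler_wpM2l ?mulr_ge0.
have HE : \sum_a ((T / N%:R) `^ p * H a) * e ^+ d <= (T / N%:R) `^ p * moment_const m.
  have -> : \sum_a ((T / N%:R) `^ p * H a) * e ^+ d =
      (T / N%:R) `^ p * (e ^+ d * \sum_a H a).
    by rewrite -mulr_suml -mulr_sumr; ring.
  apply: ler_wpM2l; first exact: powR_ge0.
  have card : e ^+ d * 2 ^+ (d * L) = 1.
    by rewrite /e mulnC exprM -exprMn mulVf ?expr1n // expf_neq0 ?pnatr_eq0.
  have mom := grid_disc_moment R L os N m.
  have fE a : (`|f a| / T) ^+ M = f a ^+ M / T ^+ M.
    rewrite exprMn exprVn; congr (_ / _).
    by rewrite /M !(exprM _ 2) real_normK // num_real.
  (* This cancels the growth of the grid moment: (L+1)^(dm) from the martingale inequality times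
     (L+1)^d from the number of components. *)
  have TM : T ^+ M = (2 ^+ t) ^+ M * (L.+1%:R ^+ d) ^+ m.+1.
    by rewrite /T exprMn /M [X in _ * X]exprM sqr_sqrtr ?exprn_ge0.
  have sumH : \sum_a H a = 2 ^+ (d * L) + 2 ^+ M * ((\sum_a f a ^+ M) / T ^+ M + 2 ^+ (d * L) * (2 * d%:R) ^+ M).
    rewrite big_split /= -mulr_sumr big_split /= mulr_suml.
    rewrite !sumr_const card_ffun card_bool card_prod !card_ord natrX.
    rewrite -[_ ^+ M *+ _]mulr_natl natrX.
    by congr (_ + _ * (_ + _)); apply: eq_bigr => a _; rewrite fE.
  rewrite sumH.
  have -> : e ^+ d * (2 ^+ (d * L) + 2 ^+ M * ((\sum_a f a ^+ M) / T ^+ M + 2 ^+ (d * L) * (2 * d%:R) ^+ M)) =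
     e ^+ d * 2 ^+ (d * L) * (1 + 2 ^+ M * (2 * d%:R) ^+ M) + 2 ^+ M * (e ^+ d * ((\sum_a f a ^+ M) / T ^+ M)).
    by ring.
  rewrite card mul1r /moment_const -/M mulrDr -addrA lerD2l [leRHS]addrC lerD2l.
  apply: ler_wpM2l; first exact: exprn_ge0.
  rewrite mulrA ler_pdivrMr ?exprn_gt0 //.
  apply: le_trans (ler_wpM2l (exprn_ge0 d e0) mom) _.
  rewrite TM le_eqVlt; apply/orP; left; apply/eqP.
  rewrite [in LHS]exprMn (exprAC _ m d) (exprS (L.+1%:R ^+ d)) !exprMn -/M.
  rewrite [LHS](_ : _ = e ^+ d * 2 ^+ (d * L) * (((4 * m).+1%:R ^+ m.+1) ^+ d * (L.+1%:R ^+ d) ^+ m * (L.+1%:R ^+ d * (4 ^+ M * (2 ^+ t) ^+ M * (4 ^+ d) ^+ M)))); last by ring.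
  by rewrite card mul1r; ring.
rewrite /Lp_discrepancy.
have int_le := integral_cells_le (v := fun a i => bin_val R (grid_digit a i) L)
   (G := fun a => (T / N%:R) `^ p * H a) (h := fun x => `|discrepancy s N x| `^ p) e0.
have H0 a : 0 <= H a.
  have u0 : 0 <= `|f a| / T by rewrite divr_ge0 // ltW.
  have v0 : 0 <= 2 * d%:R :> R by rewrite mulr_ge0.
  by apply: addr_ge0 => //; apply: mulr_ge0; [|apply: addr_ge0]; apply: exprn_ge0.
have {}int_le : (\int[lebesgue_tuple d]_(x in @unit_cube R d) (`|discrepancy s N x| `^ p)%:E <=
    ((T / N%:R) `^ p * moment_const m)%:E)%E.
  apply: le_trans (int_le _ _ _ _) _.
  - by move=> a; rewrite mulr_ge0 ?powR_ge0.
  - by move=> x; rewrite powR_ge0.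
  - apply: (@measurableT_comp _ _ _ _ _ _ (fun u : measurableTypeR R => u `^ p)).
      exact: measurable_powR.
    apply: (@measurableT_comp _ _ _ _ _ _ (fun u : measurableTypeR R => `|u|)).
      exact: normr_measurable.
    exact: measurable_discrepancy.
  - move=> x xc; have [a xa] := grid_cell_cover L xc.
    by exists a => //; apply: pw => // i; case/andP: (xc i).
  - by rewrite lee_fin.
apply: le_trans (gt0_ler_poweR (_ : 0 <= p^-1) _ _ int_le) _.
- by rewrite invr_ge0.
- by rewrite in_itv /= leey andbT; apply: integral_ge0 => x _; rewrite lee_fin powR_ge0.
- by rewrite in_itv /= leey andbT lee_fin mulr_ge0 ?powR_ge0 // (le_trans _ (moment_const_ge1 m)).
rewrite poweR_EFin lee_fin powRM ?powR_ge0 ?(le_trans _ (moment_const_ge1 m)) //.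
rewrite -powRrM mulfV ?gt_eqF ?(lt_le_trans _ p1) // powRr1 //.
(* The constant is at least 1 and 1/p at most 1, so its root of order p is at most itself. *)
apply: ler_wpM2l => //; apply: ler1_powR; first exact: moment_const_ge1.
by rewrite invf_le1 // (lt_le_trans _ p1).
Qed.

End Discrepancy_Lp.

(** With l the integer part of log_2 N, which is at least 1, L = l + 1 gives L + 1 = l + 2 <= 3l. *)
Lemma log_bound (R : realType) (N : nat) : (2 <= N)%N ->
  exists L, [/\ (0 < L)%N, (N <= 2 ^ L)%N & L.+1%:R <= 3 / ln 2 * ln N%:R :> R].
Proof.
move=> N2; exists (trunc_log 2 N).+1.
have l0 : (0 < trunc_log 2 N)%N by rewrite trunc_log_gt0.
split => //; first by rewrite ltnW // trunc_log_ltn.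
have ln20 : 0 < ln 2 :> R by rewrite ln_gt0 // ltr1n.
set l := trunc_log 2 N in l0 *.
have h : l%:R * ln 2 <= ln N%:R :> R.
  rewrite mulr_natl -lnXn // ler_ln ?posrE ?exprn_gt0 // ?ltr0n ?(ltnW N2) //.
  by rewrite -natrX ler_nat trunc_logP // ltnW.
rewrite mulrAC ler_pdivlMr //.
apply: le_trans (_ : 3 * (l%:R * ln 2) <= _); last by rewrite ler_pM2l.
rewrite mulrA ler_pM2r // -natrM ler_nat; lia.
Qed.

Theorem theorem2p2 (R : realType) (d : nat) (p : R) :
  (0 < d)%N -> 1 <= p ->
  exists C : R, 0 < C /\
    forall (t : nat) (E : 'I_d -> infinite_matrix),
      order_digital_sequence 2 t E ->
      (forall (i : 'I_d) (k l : nat), (2 * l.+1 < k.+1)%N -> E i k l = 0) ->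
      forall N : nat, (2 <= N)%N ->
        (Lp_discrepancy p (digital_sequence R E) N <=
          (C * 2 ^+ t * (ln N%:R `^ (d%:R / 2) / N%:R))%:E)%E.
Proof.
(* Any even exponent at least p would do; p < m + 1 makes 2(m + 1) one that depends on p only. *)
move=> _ p1; pose m := Num.truncn p.
have pm : p <= (2 * m.+1)%:R.
  apply: le_trans (ltW (truncnS_gt p)) _; rewrite ler_nat -/m; lia.
have ln20 : 0 < ln 2 :> R by rewrite ln_gt0 // ltr1n.
(* The factor that turns (L+1)^(d/2) into (ln N)^(d/2) through [log_bound]. *)
pose c : R := Num.sqrt ((3 / ln 2) ^+ d).
have W1 := moment_const_ge1 R d m.
exists (c * moment_const R d m); split.
  by rewrite mulr_gt0 ?(lt_le_trans _ W1) // sqrtr_gt0 exprn_gt0 // divr_gt0.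
move=> t E os E0 N N2; have [L [L0 NL hL]] := log_bound R N2.
have N0 : (0 < N)%N by apply: ltnW.
apply: le_trans (Lp_discrepancy_le os E0 L0 N0 NL p1 pm) _; rewrite lee_fin.
have lnN : 0 <= ln N%:R :> R by rewrite ln_ge0 // ler1n.
have key : Num.sqrt (L.+1%:R ^+ d) <= c * ln N%:R `^ (d%:R / 2).
  rewrite powRrM powR_mulrn // powR12_sqrt ?exprn_ge0 //.
  rewrite /c -sqrtrM ?exprn_ge0 ?divr_ge0 ?(ltW ln20) // -exprMn ler_wsqrtr //.
  by rewrite lerXn2r ?nnegrE // (le_trans _ hL).
rewrite [leRHS](_ : _ = 2 ^+ t * (c * ln N%:R `^ (d%:R / 2)) / N%:R * moment_const R d m); last by ring.
rewrite ler_wpM2r ?(le_trans _ W1) // ler_wpM2r ?invr_ge0 //.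
by rewrite ler_wpM2l // exprn_ge0.
Qed.
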